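(* $\mathrm{ex}(n,K_{3,30}')=\Theta(n^{4/3})$ as $n\to\infty$; that is, there exist constants $c,C>0$ and an integer $n_0$ such that $c\,n^{4/3}\le \mathrm{ex}(n,K_{3,30}')\le C\,n^{4/3}$ for all $n\ge n_0$.
   Context: All graphs are finite, simple and undirected. For a graph $H$, the Turán number $\mathrm{ex}(n,H)$ is the maximum number of edges in an $n$-vertex graph that does not contain $H$ as a (not necessarily induced) subgraph. The 1-subdivision of $H$, denoted $H'$, is the graph obtained from $H$ by replacing the edges of $H$ by internally disjoint paths of length $2$ (i.e. each edge is subdivided by exactly one new vertex). $K_{s,t}$ is the complete bipartite graph with parts of sizes $s$ and $t$, and $K_{s,t}'$ is its 1-subdivision. *)

(* Defs.v *)
From HB Require Import structures.
From mathcomp Require Import all_boot.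

Set Implicit Arguments.
Unset Strict Implicit.
Unset Printing Implicit Defensive.

(* A simple graph on the vertex set T is given by its set of edges, each edge
   being the set of its two endpoints. *)
Record sgraph (T : finType) := SGraph {
  edges : {set {set T}};
  edgesP : [forall e in edges, #|e| == 2] }.

HB.instance Definition _ (T : finType) := [isSub for @edges T].
HB.instance Definition _ (T : finType) := [Finite of sgraph T by <:].

(* Since edges have exactly two elements, this forces x != y. *)
Definition adj (T : finType) (G : sgraph T) : rel T :=
  fun x y => [set x; y] \in edges G.

(* G contains H as a (not necessarily induced) subgraph. *)
Definition contains (T U : finType) (G : sgraph T) (H : sgraph U) : bool :=
  [exists f : {ffun U -> T},
    injectiveb f && [forall x, forall y, adj H x y ==> adj G (f x) (f y)]].

(* The Turan number ex(n, H), with value 0 when there is no H-free graph on n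
   vertices, which can only happen when H has no edge. *)
Definition turan (n : nat) (U : finType) (H : sgraph U) : nat :=
  \max_(G : sgraph 'I_n | ~~ contains G H) #|edges G|.

Definition Kst_edges (s t : nat) : {set {set 'I_s + 'I_t}} :=
  [set [set inl i; inr j] | i in 'I_s, j in 'I_t].

Lemma Kst_edgesP s t : [forall e in Kst_edges s t, #|e| == 2].
Proof.
by apply/forall_inP => _ /imset2P[i j _ _ ->]; rewrite cards2.
Qed.

Definition Kst (s t : nat) : sgraph ('I_s + 'I_t)%type :=
  SGraph (Kst_edgesP s t).

(* The vertices of the 1-subdivision are the vertices of H together with one
   new vertex for each edge e of H, joined to both endpoints of e. *)
Definition subdiv_vertex (U : finType) (H : sgraph U) : finType :=
  (U + {e : {set U} | e \in edges H})%type.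

Definition subdiv_edges (U : finType) (H : sgraph U) :
    {set {set subdiv_vertex H}} :=
  [set [set (inl p.1 : subdiv_vertex H); inr p.2]
    | p : U * {e : {set U} | e \in edges H} & p.1 \in val p.2].

Lemma subdiv_edgesP (U : finType) (H : sgraph U) :
  [forall e in subdiv_edges H, #|e| == 2].
Proof.
by apply/forall_inP => _ /imsetP[p _ ->]; rewrite cards2.
Qed.

Definition subdivision (U : finType) (H : sgraph U) :
    sgraph (subdiv_vertex H) :=
  SGraph (subdiv_edgesP H).

(* Main.v *)
Require Import Defs.
From mathcomp Require Import all_boot all_order all_algebra.
From mathcomp Require Import reals exp.
From mathcomp Require Import finfield ring zify.

(** Both bounds concern three roots x1, x2, x3 and the vertices y reached from
    each of them by a path of length 2. A subdivided K_{3,t} is a set of t such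
    vertices y whose 3t middle vertices are distinct.

    Lower bound. Let F have characteristic 3 and q elements. Join the points
    (a, u, v) and (t, p, s) of F^3, with a and t nonzero, when

      u + p = a t   and   v + s = a^2 t^3 + a^3 t^2.

    This graph has q^3 vertices and about q^4 / 2 edges ([point_graph_edges]).
    If (b, u, v) has a common neighbour with another point (a, u', v'), then
    b <> a and

      (b - a)^2 (v - v') = (b + a) (u - u')^3 + (b - a)^3 (u - u')^2

    ([linked_eqn]), so the points y reached from three roots lie on three
    surfaces. At most 26 of them are reached by paths with distinct middle
    vertices ([linked3_count]), hence there is no subdivided K_{3,30}. As the
    defining equations are symmetric, the roots may be any three vertices.

    To count the intersection points when the a_i are distinct, one eliminates v.
    Two combinations remain: a cubic in u, and a quadratic in u, because in
    characteristic 3 the terms u^3 and u'^3 separate and a suitable combination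
    of the three equations contains neither v nor u^3. Their coefficients are
    polynomials in b. Eliminating u gives a polynomial in b of degree at most 26,
    whose roots count the solutions with multiplicity ([elim_count]). If it
    vanished identically, the surfaces would share a curve u = u(b) with u
    rational. The denominator of u would divide two coprime polynomials of degree
    at most 1, so u would be a polynomial; comparing degrees, u would be affine
    ([common_curve]); and at b = a_i it would take the value u_i, so that the
    points (a_i, u_i) would be collinear. For collinear roots the same
    elimination is made after subtracting from u the affine function of the line.
    Points y on the line itself must be discarded, and may be: the three
    middle vertices of such a y coincide.

    Fields with 3^k elements give a lower bound for every n, since consecutive
    values of 27^k differ by a bounded factor.

    Upper bound. In a graph on n vertices without a subdivided K_{3,t}, let m
    vertices have degree at least D, and let N w consist of D neighbours of such a
    vertex w. Then m^2 D^3 = O(n^3) ([high_degree_count]), and summing over the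
    values D = 4^j n^(1/3) gives O(n^(4/3)) edges ([degree_sum_bound]).

    Call two vertices light if they have at least one but fewer than some
    constant number of common neighbours w. Pairwise heavy vertices are few,
    since the middle vertices can be chosen greedily; so by Turan's theorem a
    positive proportion of the pairs in each N w is light ([light_density]).
    By convexity there are at least about (m D^2)^3 / n^2 quadruples (x1, x2,
    x3; y) with y light to each x_i. On the other hand, if there are many y
    for given roots, then a positive proportion of them must use one and the
    same middle vertex w, next to x_i say, or else t of them could be chosen
    with distinct middle vertices ([clean_bound]). These y lie in N w and are
    light to x_j and x_k. If that set is large, it contains many triangles of
    the light graph ([many_triangles]). But the number of vertices light to
    all vertices of a light triangle is O(D), again by [clean_bound], now with
    the triangle as the roots ([triangle_codegree]). Counting triangles with
    two such vertices in both ways ([richness_bound]) gives the inequality. *)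

Set Implicit Arguments.
Unset Strict Implicit.
Unset Printing Implicit Defensive.

(** * Simple graphs and subdivided bicliques *)

Section SimpleGraphs.
Variable T : finType.
Implicit Types (G : sgraph T) (x y : T).

Lemma adj_sym G x y : adj G x y = adj G y x.
Proof. by rewrite /adj setUC. Qed.

Lemma adj_neq G x y : adj G x y -> x != y.
Proof.
move=> exy; have /forall_inP/(_ _ exy) := edgesP G.
by rewrite cards2; case: (x != y).
Qed.

Definition nbrs G x := [set y | adj G x y].

Lemma incident_nbrs G x : #|[set e in edges G | x \in e]| = #|nbrs G x|.
Proof.
have inj : injective (fun y : T => [set x; y]).
  move=> y z /setP E; have := E y; have := E z; rewrite !inE !eqxx !orbT.
  by case: eqVneq => [-> /=|_ /= /eqP //]; case: eqVneq => //= _ /esym/eqP.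
rewrite -(card_imset _ inj); apply: eq_card => e; rewrite !inE.
apply/andP/imsetP => [[eG xe]|[y]]; last by rewrite inE => xy ->; rewrite set21.
have /forall_inP/(_ _ eG)/cards2P[a [b [nab de]]] := edgesP G.
move: xe; rewrite de !inE => /orP[] /eqP->; [exists b | exists a] => //.
- by rewrite inE /adj -de.
- by rewrite inE /adj setUC -de.
- by rewrite setUC.
Qed.

Lemma handshake G : \sum_x #|nbrs G x| = #|edges G|.*2.
Proof.
transitivity (\sum_x \sum_(e in edges G) (x \in e : nat)).
  apply: eq_bigr => x _; rewrite -incident_nbrs -sum1_card big_mkcond /=.
  rewrite [RHS]big_mkcond; apply: eq_bigr => e _; rewrite inE.
  by case: (e \in edges G); case: (x \in e).
rewrite exchange_big /= -muln2 -sum_nat_const; apply: eq_bigr => e eG.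
have /forall_inP/(_ _ eG)/eqP <- := edgesP G.
by rewrite -sum1_card [RHS]big_mkcond; apply: eq_bigr => x _; case: (x \in e).
Qed.

End SimpleGraphs.

Section SubdividedBiclique.
Variables s t : nat.

(** All vertices of the subdivided biclique in one family: its injectivity
    says that branch vertices and middle vertices are all distinct. *)
Definition assemble (T : Type) (x : 'I_s -> T) (y : 'I_t -> T) (w : 'I_s -> 'I_t -> T)
    (v : 'I_s + 'I_t + 'I_s * 'I_t) : T :=
  match v with
  | inl (inl i) => x i
  | inl (inr j) => y j
  | inr (i, j) => w i j
  end.

Lemma adj_subdivision (U : finType) (H : sgraph U) (v v' : subdiv_vertex H) :
  adj (subdivision H) v v' ->
  exists u (e : {e : {set U} | e \in edges H}), u \in val e /\
    ((v = inl u /\ v' = inr e) \/ (v = inr e /\ v' = inl u)).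
Proof.
rewrite /adj /= => /imsetP[[u e]]; rewrite inE /= => ue E; exists u, e; split=> //.
have Ein z : (z \in [set v; v']) = (z \in [set (inl u : subdiv_vertex H); inr e]).
  by rewrite E.
have /set2P[ev|ev] : v \in [set (inl u : subdiv_vertex H); inr e] by rewrite -Ein set21.
all: have /set2P[ev'|ev'] : v' \in [set (inl u : subdiv_vertex H); inr e]
  by rewrite -Ein set22.
- by have := Ein (inr e); rewrite ev ev' !inE eqxx orbT.
- by left.
- by right.
- by have := Ein (inl u); rewrite ev ev' !inE eqxx.
Qed.

Lemma subdivision_adj (U : finType) (H : sgraph U) u (e : {e : {set U} | e \in edges H}) :
  u \in val e -> adj (subdivision H) (inl u) (inr e).
Proof. by move=> ue; apply/imsetP; exists (u, e); rewrite ?inE. Qed.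

Lemma mem_Kst_edge (i : 'I_s) (j : 'I_t) :
  [set inl i; inr j] \in edges (Kst s t).
Proof. by apply/imset2P; exists i j. Qed.

Definition Kst_edge i j : {e : {set 'I_s + 'I_t} | e \in edges (Kst s t)} :=
  Sub [set inl i; inr j] (mem_Kst_edge i j).

Lemma Kst_edge_inj i j i' j' : Kst_edge i j = Kst_edge i' j' -> (i, j) = (i', j').
Proof.
move/(congr1 val)/setP => /= E.
have := E (inl i); have := E (inr j); rewrite !inE !eqxx ?orbT /=.
move=> /esym/eqP[->] /esym; rewrite orbF => /eqP[->] //.
Qed.

Lemma Kst_edge_surj (e : {e : {set 'I_s + 'I_t} | e \in edges (Kst s t)}) :
  exists ij, e == Kst_edge ij.1 ij.2.
Proof.
have /imset2P[i j _ _ E] := valP e.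
by exists (i, j); apply/eqP/val_inj.
Qed.

(** The middle vertices are indexed by pairs (i, j) instead of edges of the
    biclique; this is the only form in which containment is used below. *)
Lemma contains_subdivisionP (T : finType) (G : sgraph T) :
  reflect (exists (x : 'I_s -> T) (y : 'I_t -> T) (w : 'I_s -> 'I_t -> T),
      injective (assemble x y w) /\
      forall i j, adj G (x i) (w i j) /\ adj G (w i j) (y j))
    (contains G (subdivision (Kst s t))).
Proof.
apply: (iffP existsP) => [[f /andP[/injectiveP inj_f /forallP hom]]|].
  have homf v v' : adj (subdivision (Kst s t)) v v' -> adj G (f v) (f v').
    by have /forallP/(_ v')/implyP := hom v.
  exists (fun i => f (inl (inl i))), (fun j => f (inl (inr j))),
         (fun i j => f (inr (Kst_edge i j))); split.
    by move=> [[i|j]|[i j]] [[i'|j']|[i' j']] /= /inj_f // => -[];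
      [move->|move->|move/setP => E; congr inr; apply: Kst_edge_inj; apply/val_inj/setP].
  move=> i j; split; first by apply/homf/subdivision_adj; rewrite set21.
  by rewrite adj_sym; apply/homf/subdivision_adj; rewrite set22.
case=> x [y [w [inj_a adjs]]].
pose idx e := xchoose (Kst_edge_surj e).
have idxP e : e = Kst_edge (idx e).1 (idx e).2 by apply/eqP/(xchooseP (Kst_edge_surj e)).
pose g (v : subdiv_vertex (Kst s t)) : 'I_s + 'I_t + 'I_s * 'I_t :=
  match v with inl u => inl u | inr e => inr (idx e) end.
have inj_g : injective g.
  by move=> [u|e] [u'|e'] //= [] => [->|E] //; rewrite [e]idxP [e']idxP E.
exists [ffun v => assemble x y w (g v)]; apply/andP; split.
  by apply/injectiveP => v v'; rewrite !ffunE => /inj_a/inj_g.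
apply/forallP => v; apply/forallP => v'; apply/implyP.
have half u (e : {e : {set 'I_s + 'I_t} | e \in edges (Kst s t)}) : u \in val e ->
    adj G (assemble x y w (g (inl u))) (assemble x y w (g (inr e))).
  rewrite {1}[e]idxP /=; case: (idx e) => i j /=; have [xw wy] := adjs i j.
  by rewrite !inE => /orP[] /eqP-> //; rewrite adj_sym.
case/adj_subdivision => u [e [ue [[-> ->]|[-> ->]]]]; rewrite !ffunE; first exact: half.
by rewrite adj_sym; apply: half.
Qed.

End SubdividedBiclique.

(** Isolated vertices may be added to reach n vertices: every vertex of the
    subdivided biclique has a neighbour, so a copy of it avoids them. *)
Lemma leq_turan (T : finType) (G : sgraph T) (s t n : nat) : (0 < s)%N -> (0 < t)%N ->
  (#|T| <= n)%N -> ~~ contains G (subdivision (Kst s t)) ->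
  (#|edges G| <= turan n (subdivision (Kst s t)))%N.
Proof.
move=> s_gt0 t_gt0 leTn freeG.
pose h (x : T) : 'I_n := widen_ord leTn (enum_rank x).
have inj_h : injective h.
  by move=> x y /(congr1 val) /= E; apply/enum_rank_inj/val_inj.
pose E' := [set h @: (e : {set T}) | e in edges G].
have E'P : [forall e in E', #|e| == 2].
  apply/forall_inP => _ /imsetP[e eG ->]; rewrite card_imset //.
  by have /forall_inP/(_ _ eG) := edgesP G.
pose G' := SGraph E'P.
have adjG' a b : adj G' a b -> exists x y, [/\ a = h x, b = h y & adj G x y].
  rewrite /adj => /imsetP[e eG E].
  have /forall_inP/(_ _ eG)/cards2P[x [y [nxy de]]] := edgesP G.
  have nhxy : h x != h y by apply: contra nxy => /eqP/inj_h->.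
  move: E; rewrite de imsetU1 imset_set1 => E; rewrite de in eG.
  have Ein z : (z \in [set a; b]) = (z \in [set h x; h y]) by rewrite E.
  have /set2P memb : b \in [set h x; h y] by rewrite -Ein set22.
  have /set2P[ea|ea] : a \in [set h x; h y] by rewrite -Ein set21.
  case: memb => eb.
  - by have := Ein (h y); rewrite ea eb !inE eqxx orbT orbb eq_sym (negPf nhxy).
  - by exists x, y.
  case: memb => eb.
  - by exists y, x; split=> //; rewrite /adj setUC.
  - by have := Ein (h x); rewrite ea eb !inE eqxx orbb (negPf nhxy).
have cardG' : #|edges G'| = #|edges G|.
  by rewrite card_imset //; apply: imset_inj.
rewrite -cardG'; apply: leq_bigmax_cond.
apply: contra freeG => /contains_subdivisionP[x [y [w [inj_a adjs]]]].
apply/contains_subdivisionP.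
pose i0 := Ordinal s_gt0; pose j0 := Ordinal t_gt0.
have inv a b : adj G' a b -> exists x', h x' == a.
  by case/adjG' => x' [y' [-> _ _]]; exists x'; rewrite eqxx.
have invx i : exists x', h x' == x i by apply: inv; have [H _] := adjs i j0; exact: H.
have invw i j : exists x', h x' == w i j by apply: inv; have [_ H] := adjs i j; exact: H.
have invy j : exists x', h x' == y j.
  by apply: inv; have [_ H] := adjs i0 j; rewrite adj_sym in H; exact: H.
pose x' i := xchoose (invx i); pose y' j := xchoose (invy j); pose w' i j := xchoose (invw i j).
have hx i : h (x' i) = x i by apply/eqP/(xchooseP (invx i)).
have hy i : h (y' i) = y i by apply/eqP/(xchooseP (invy i)).
have hw i j : h (w' i j) = w i j by apply/eqP/(xchooseP (invw i j)).
have unadj a b : adj G' (h a) (h b) -> adj G a b.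
  by case/adjG' => c [d [/inj_h-> /inj_h->]].
exists x', y', w'; split.
  have ha v : h (assemble x' y' w' v) = assemble x y w v by case: v => [[i|j]|[i j]] /=.
  by move=> u v E; apply: inj_a; rewrite -!ha E.
by move=> i j; have [xw wy] := adjs i j; split; apply: unadj; rewrite ?hx ?hw ?hy.
Qed.

(** * Convexity, independent sets and greedy choice *)

(** Reduces the inequalities of Cauchy-Schwarz type below to the termwise
    inequality 2xy <= x^2 + y^2. *)
Lemma leq_sum_sym (I : finType) (f g : I -> I -> nat) :
  (forall i j, f i j + f j i <= g i j + g j i) ->
  \sum_i \sum_j f i j <= \sum_i \sum_j g i j.
Proof.
move=> le_fg; rewrite -leq_double -!addnn.
have sym (h : I -> I -> nat) : \sum_i \sum_j h i j + \sum_i \sum_j h i j =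
    \sum_i \sum_j (h i j + h j i).
  rewrite {2}exchange_big -big_split; apply: eq_bigr => i _.
  by rewrite -big_split.
by rewrite !sym; apply: leq_sum => i _; apply: leq_sum => j _.
Qed.

Lemma sqr_sum_leq (I : finType) (A : {set I}) (a : I -> nat) :
  (\sum_(i in A) a i) ^ 2 <= #|A| * \sum_(i in A) a i ^ 2.
Proof.
pose b i := (i \in A) * a i.
have -> : \sum_(i in A) a i = \sum_i b i.
  by rewrite big_mkcond; apply: eq_bigr => i _; rewrite /b; case: (i \in A); rewrite ?mul1n.
have -> : #|A| * \sum_(i in A) a i ^ 2 = \sum_i \sum_j (i \in A) * b j ^ 2.
  have -> : \sum_(i in A) a i ^ 2 = \sum_i b i ^ 2.
    by rewrite big_mkcond; apply: eq_bigr => i _; rewrite /b; case: (i \in A); rewrite ?mul1n.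
  rewrite -sum1_card big_distrl /= big_mkcond; apply: eq_bigr => i _.
  by rewrite -big_distrr /=; case: (i \in A).
rewrite expnS expn1 big_distrl /=.
under eq_bigr do rewrite big_distrr /=.
apply: leq_sum_sym => i j; rewrite /b.
case: (i \in A) (j \in A) => [] []; rewrite ?mul1n ?mul0n ?muln0 //.
move: (nat_Cauchy (a i) (a j)).1; move: (a i) (a j) => x y.
rewrite ?expnS ?expn0 ?muln1; nia.
Qed.

Lemma cube_sum_leq (I : finType) (a : I -> nat) :
  (\sum_i a i) ^ 3 <= #|I| ^ 2 * \sum_i a i ^ 3.
Proof.
have S1 : (\sum_i a i) ^ 2 <= #|I| * \sum_i a i ^ 2.
  by have := sqr_sum_leq [set: I] a; rewrite cardsT; under eq_bigl do rewrite inE;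
     under [in X in _ <= X -> _]eq_bigl do rewrite inE.
have S2 : (\sum_i a i ^ 2) ^ 2 <= (\sum_i a i) * \sum_i a i ^ 3.
  rewrite expnS expn1 !big_distrl /=.
  under eq_bigr do rewrite big_distrr /=.
  under [leqRHS]eq_bigr do rewrite big_distrr /=.
  apply: leq_sum_sym => i j; move: (nat_Cauchy (a i) (a j)).1; move: (a i) (a j) => x y.
rewrite ?expnS ?expn0 ?muln1; nia.
move: S1 S2; set s := \sum_i a i; set q := \sum_i a i ^ 2; set c := \sum_i a i ^ 3.
have [->|s_gt0] := posnP s; first by rewrite exp0n.
move=> S1 S2; rewrite -(leq_pmul2l s_gt0).
apply: (@leq_trans ((#|I| * q) ^ 2)).
  by rewrite -expnS -[4]/(2 * 2) expnM leq_exp2r.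
rewrite expnMn; apply: (@leq_trans (#|I| ^ 2 * (s * c))); first by rewrite leq_mul2l S2 orbT.
by rewrite mulnCA.
Qed.

Section Independent.
Variables (T : finType) (e : rel T).

Definition closed_nbhd (S : {set T}) x := [set y in S | (y == x) || e x y].

(** Turan's theorem, by removing a closed neighbourhood of the smallest size
    d. Its d vertices contribute at least d^2 to the sum, and the induction
    step is d^2 + r^2 / j >= (d + r)^2 / (j + 1), where r vertices remain. *)
Lemma turan_independent j (S : {set T}) :
  (exists l : seq T, [/\ size l = j.+1, {subset l <= S} &
     pairwise (fun x y => ~~ ((y == x) || e x y)) l]) \/
  #|S| ^ 2 <= j * \sum_(x in S) #|closed_nbhd S x|.
Proof.
elim: j S => [|j IHj] S.
  have [->|[x xS]] := set_0Vmem S; first by right; rewrite cards0.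
  by left; exists [:: x]; split=> // y; rewrite inE => /eqP->.
have [->|[x0 x0S]] := set_0Vmem S; first by right; rewrite cards0.
have [x] := arg_minnP (fun x => #|closed_nbhd S x|) x0S.
move=> xS minx; have {}xS : x \in S := xS.
set S' := S :\: closed_nbhd S x; set d := #|closed_nbhd S x|.
have xx : x \in closed_nbhd S x by rewrite inE xS eqxx.
have [[l [size_l sub_l indep_l]]|le_S'] := IHj S'.
  left; exists (x :: l); split=> [|y|]; first by rewrite /= size_l.
    by rewrite inE => /orP[/eqP->//|/sub_l]; rewrite inE => /andP[].
  rewrite pairwise_cons indep_l andbT; apply/allP => y /sub_l.
  by rewrite !inE negb_and; case: (y \in S); rewrite ?andbF //= andbT.
right; have cS : #|S| = d + #|S'|.
  by rewrite -(cardsID (closed_nbhd S x) S) (setIidPr _) //; apply/subsetP => y; rewrite inE => /andP[].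
have lo : d * d + \sum_(y in S') #|closed_nbhd S' y| <= \sum_(y in S) #|closed_nbhd S y|.
  rewrite [leqRHS](bigID (mem (closed_nbhd S x))) /=; apply: leq_add.
    rewrite /d -sum_nat_const [leqRHS](eq_bigl (fun y => y \in closed_nbhd S x)); last first.
      by move=> y; rewrite /= !inE; case: (y \in S).
    by apply: leq_sum => y; rewrite inE => /andP[yS _]; apply: minx.
  rewrite [leqRHS](eq_bigl (fun y => y \in S')); last by move=> y; rewrite /= !inE andbC.
  apply: leq_sum => y _; apply: subset_leq_card; apply/subsetP => z.
  by rewrite !inE => /andP[/andP[_ ->] ->].
move: lo le_S'; rewrite cS /d.
move: (\sum_(y in S') _) (\sum_(y in S) _) (#|S'|) #|_| => b a s' r lo le_S'.
apply: leq_trans (_ : j.+1 * (r * r + b) <= _); last by rewrite leq_mul2l lo orbT.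
case: j le_S' {IHj} => [|j] le_S'.
  have -> : s' = 0 by move: le_S'; rewrite mul0n leqn0 expn_eq0 andbT => /eqP.
  by rewrite addn0 mul1n mulnn leq_addr.
rewrite -(leq_pmul2l (ltn0Sn j)).
have := (nat_Cauchy (j.+1 * r) s').1; rewrite ?expnS ?expn0 ?muln1; nia.
Qed.

End Independent.

(** Each choice is obstructed only by A and by the fewer than #|I| elements
    chosen before it. *)
Lemma greedy_sdr (I T : finType) (C : I -> {set T}) (A : {set T}) :
  (forall i, #|A| + #|I| <= #|C i|) ->
  exists w : I -> T, injective w /\ forall i, w i \in C i :\: A.
Proof.
move=> big_C.
have w0 i : exists x, x \in C i.
  apply/card_gt0P; apply: leq_trans (big_C i); rewrite addn_gt0 orbC.
  by have -> : 0 < #|I| by apply/card_gt0P; exists i.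
suff [w [inj_w wC]] : exists w : I -> T, {in enum I &, injective w} /\
    forall i, i \in enum I -> w i \in C i :\: A.
  exists w; split=> [i j E|i]; last by rewrite wC ?mem_enum.
  by apply: inj_w; rewrite ?mem_enum.
have := enum_uniq I; have : size (enum I) <= #|I| by rewrite -cardT.
elim: (enum I) => [|i s IHs] /= => [_ _|lt_s /andP[nis uniq_s]].
  by exists (fun i => xchoose (w0 i)).
have [w [inj_w wC]] := IHs (ltnW lt_s) uniq_s.
have /subsetPn[z zC] : ~~ (C i \subset A :|: [set w j | j in s]).
  apply/negP => /subset_leq_card; rewrite leqNgt => /negP[].
  apply: leq_trans (big_C i); apply: (@leq_ltn_trans (#|A| + size s)).
    apply: leq_trans (leq_card_setU _ _) _; rewrite leq_add2l.
    exact: leq_trans (leq_imset_card _ _) (card_size _).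
  by rewrite ltn_add2l.
rewrite inE negb_or => /andP[nzA nzw].
have new j : j \in s -> (j == i) = false.
  by move=> js; apply: contraNF nis => /eqP <-.
exists (fun j => if j == i then z else w j); split=> [j j'|j].
  rewrite !inE => /orP[/eqP->|js] /orP[/eqP->|js'] //; rewrite ?eqxx ?new //.
  - by move=> E; case/negP: nzw; rewrite E imset_f.
  - by move=> E; case/negP: nzw; rewrite -E imset_f.
  - exact: inj_w.
rewrite inE => /orP[/eqP->|js]; first by rewrite eqxx inE nzA.
by rewrite new // wC.
Qed.

Lemma leq_card_cover (T I : finType) (A A0 : {set T}) (C : I -> {set T}) :
  (forall x, x \in A -> x \in A0 \/ exists i, x \in C i) ->
  #|A| <= #|A0| + \sum_i #|C i|.
Proof.
move=> covA; apply: (@leq_trans (#|A0| + #|\bigcup_i C i|)).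
  apply: leq_trans (leq_card_setU _ _); apply/subset_leq_card/subsetP => x /covA.
  by rewrite inE => -[->//|[i xi]]; apply/orP; right; apply/bigcupP; exists i.
rewrite leq_add2l; elim/big_rec2: _ => [|i a A' _ le_a]; first by rewrite cards0.
by rewrite (leq_trans (leq_card_setU _ _)) // leq_add2l.
Qed.

(** * Light pairs and the number of vertices of large degree *)

(** Only the vertices of B serve as middle vertices, and each keeps exactly D
    of its neighbours. This makes the middle vertices regular; the degrees of
    the branch vertices are handled by convexity. *)
Section Core.
Variables (T : finType) (B : {set T}) (N : T -> {set T}) (D t : nat).
Hypothesis card_N : forall w, w \in B -> #|N w| = D.
Hypothesis N_irr : forall w, w \notin N w.
Hypothesis t_gt0 : 0 < t.
Hypothesis theta_free :
  ~ exists (x : 'I_3 -> T) (y : 'I_t -> T) (w : 'I_3 -> 'I_t -> T),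
      injective (assemble x y w) /\
      forall i j, [/\ w i j \in B, x i \in N (w i j) & y j \in N (w i j)].

Implicit Types (x y z w p r v : T) (S : {set T}).

Definition common x y := [set w in B | (x \in N w) && (y \in N w)].
(** With this many common neighbours, one is always left after excluding the 3
    + t branch vertices and the other middle vertices, of which there are
    fewer than 3 t. *)
Definition heavy_bound := 3 * t + (3 + t).
Definition light x y := (x != y) && (0 < #|common x y| < heavy_bound).
Definition lights x := [set y | light x y].

Lemma common_sym x y : common x y = common y x.
Proof. by apply/setP => w; rewrite !inE [(x \in _) && _]andbC. Qed.

Lemma light_sym x y : light x y = light y x.
Proof. by rewrite /light common_sym eq_sym. Qed.

Lemma light_neq x y : light x y -> x != y. Proof. by case/andP. Qed.

Lemma mem_common x y w : w \in common x y -> [/\ w \in B, x \in N w & y \in N w].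
Proof. by rewrite inE => /and3P[]. Qed.

(** Choose the branch vertices in the clique, and then the middle vertices
    greedily. *)
Lemma no_heavy_clique (l : seq T) : size l = (3 + t) ->
  pairwise (fun x y => (x != y) && (heavy_bound <= #|common x y|)) l -> False.
Proof.
move=> size_l pw_l.
have [x0 _] : exists x0, x0 \in l.
  by case: l size_l pw_l => // x0 l' _ _; exists x0; rewrite mem_head.
have uniq_l : uniq l.
  by rewrite uniq_pairwise; apply: sub_pairwise pw_l => a b /andP[].
move/(pairwiseP x0): pw_l => pw_l.
pose x (i : 'I_3) := nth x0 l i; pose y (j : 'I_t) := nth x0 l (3 + j).
have lt_x (i : 'I_3) : i < size l by rewrite size_l ltn_addr.
have lt_y (j : 'I_t) : 3 + j < size l by rewrite size_l ltn_add2l.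
have big_C (ij : 'I_3 * 'I_t) :
    #|[set a in l]| + #|{: 'I_3 * 'I_t}| <= #|common (x ij.1) (y ij.2)|.
  have /andP[_ le_c] : (x ij.1 != y ij.2) && (heavy_bound <= #|common (x ij.1) (y ij.2)|).
    by apply: pw_l; rewrite ?inE //= (leq_trans (ltn_ord _)) // leq_addr.
  apply: leq_trans le_c; rewrite card_prod !card_ord addnC leq_add2l -size_l.
  by rewrite cardsE card_size.
have [w [inj_w wC]] := greedy_sdr big_C.
have wl i j : w (i, j) \notin l by have := wC (i, j); rewrite !inE => /andP[].
apply: theta_free; exists x, y, (fun i j => w (i, j)); split=> [|i j]; last first.
  by have := wC (i, j); rewrite inE => /andP[_ /mem_common[? ? ?]].
have xl i : x i \in l by apply: mem_nth.
have yl j : y j \in l by apply: mem_nth.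
move=> [[i|j]|[i j]] [[i'|j']|[i' j']] /= E.
- by congr (inl (inl _)); apply/val_inj/eqP; rewrite /= -(nth_uniq x0 _ _ uniq_l) //; apply/eqP.
- have /eqP : (i : nat) = 3 + j' by apply/eqP; rewrite -(nth_uniq x0 _ _ uniq_l) //; apply/eqP.
  by rewrite ltn_eqF // (leq_trans (ltn_ord i)) // leq_addr.
- by have := wl i' j'; rewrite -E xl.
- have /eqP : (i' : nat) = 3 + j by apply/eqP; rewrite -(nth_uniq x0 _ _ uniq_l) //; apply/eqP/esym.
  by rewrite ltn_eqF // (leq_trans (ltn_ord i')) // leq_addr.
- congr (inl (inr _)); apply/val_inj/eqP.
  by rewrite -(eqn_add2l 3) -(nth_uniq x0 (lt_y j) (lt_y j') uniq_l); apply/eqP.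
- by have := wl i' j'; rewrite -E yl.
- by have := wl i j; rewrite E xl.
- by have := wl i j; rewrite E yl.
- by move/inj_w: E => ->.
Qed.

Definition kappa := 2 + t.

(** Any two vertices of N w have the common neighbour w, so they are heavy if
    not light, and independent sets of the light graph on S have at most 2 + t
    vertices. *)
Lemma light_density S w : w \in B -> S \subset N w ->
  #|S| ^ 2 <= kappa * (\sum_(x in S) #|lights x :&: S| + #|S|).
Proof.
move=> wB SN.
have [[l [size_l sub_l pw_l]]|le_S] := @turan_independent _ light kappa S.
  case: (@no_heavy_clique l) => //.
  have sub_N : {in l &, forall x y, 0 < #|common x y|}.
    move=> x y /sub_l/(subsetP SN) xN /sub_l/(subsetP SN) yN.
    by apply/card_gt0P; exists w; rewrite inE wB xN.
  apply: (@sub_in_pairwise _ (mem l)) pw_l; last exact/allP.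
  move=> x y xl yl /=; rewrite negb_or eq_sym => /andP[nxy].
  by rewrite /light nxy (sub_N x y) //= -leqNgt.
apply: leq_trans le_S _; rewrite leq_mul2l; apply/orP; right.
rewrite -sum1_card -big_split; apply: leq_sum => x xS /=; rewrite addn1.
have -> : closed_nbhd light S x = x |: (lights x :&: S).
  by apply/setP => y; rewrite !inE; case: eqVneq => [->|_] /=; rewrite ?xS // andbC.
by rewrite cardsU1; case: (_ \notin _).
Qed.

(** A light pair lies in fewer than [heavy_bound] of the sets N w. *)
Lemma many_light : 2 * kappa <= D ->
  #|B| * D ^ 2 <= 2 * kappa * heavy_bound * \sum_x #|lights x|.
Proof.
move=> leD.
have per w : w \in B -> D ^ 2 <= 2 * kappa * \sum_(x in N w) #|lights x :&: N w|.
  move=> wB; have := light_density wB (subxx _); rewrite card_N //.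
  move: (\sum_(x in _) _) leD; rewrite -mulnn /kappa; nia.
apply: (@leq_trans (\sum_(w in B) 2 * kappa * \sum_(x in N w) #|lights x :&: N w|)).
  by rewrite -sum_nat_const; apply: leq_sum.
rewrite -big_distrr /= -[leqRHS]mulnA leq_mul2l; apply/orP; right.
have -> : \sum_(w in B) \sum_(x in N w) #|lights x :&: N w| =
    \sum_x \sum_(y in lights x) #|common x y|.
  transitivity (\sum_(w in B) \sum_x \sum_(y in lights x) ((x \in N w) && (y \in N w))).
    apply: eq_bigr => w _; rewrite big_mkcond; apply: eq_bigr => x _.
    case: (x \in N w) => /=; last by rewrite big1.
    by rewrite -sum1_card big_mkcond [RHS]big_mkcond; apply: eq_bigr => y _;
       rewrite !inE; case: (light x y); case: (y \in N w).
  rewrite exchange_big; apply: eq_bigr => x _; rewrite exchange_big; apply: eq_bigr => y _.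
  rewrite -sum1_card big_mkcond [RHS]big_mkcond; apply: eq_bigr => w _.
  by rewrite inE; case: (w \in B) => //=; case: (_ && _).
rewrite big_distrr; apply: leq_sum => x _ /=; rewrite mulnC -sum_nat_const.
by apply: leq_sum => y; rewrite inE => /and3P[_ _ /ltnW].
Qed.

Definition triangles S := [set y : T * T * T |
  [&& y.1.1 \in S, y.1.2 \in S, y.2 \in S, light y.1.1 y.1.2, light y.1.1 y.2 & light y.1.2 y.2]].

Lemma card_triangles S :
  #|triangles S| = \sum_(x in S) \sum_(y in lights x :&: S) #|lights y :&: (lights x :&: S)|.
Proof.
transitivity (\sum_x \sum_y \sum_z ((x, y, z) \in triangles S)).
  rewrite -sum1_card big_mkcond /= pair_big pair_big /=.
  by apply: eq_bigr => -[[x y] z] _ /=; case: (_ \in _).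
rewrite [RHS]big_mkcond; apply: eq_bigr => x _; case xS: (x \in S); last first.
  by rewrite big1 // => y _; rewrite big1 // => z _; rewrite inE /= xS.
rewrite [RHS]big_mkcond; apply: eq_bigr => y _; rewrite !inE.
case xy: (light x y); case yS: (y \in S) => /=; last 3 first.
- by rewrite big1 // => z _; rewrite inE /= xy yS !andbF.
- by rewrite big1 // => z _; rewrite inE /= xy yS !andbF.
- by rewrite big1 // => z _; rewrite inE /= xy yS !andbF.
rewrite -sum1_card [RHS]big_mkcond; apply: eq_bigr => z _.
rewrite !inE /= xS yS xy /=.
by case: (z \in S); case: (light x z); case: (light y z).
Qed.

(** Apply [light_density] to S, and then to the light neighbourhood in S of
    each vertex of S. *)
Lemma many_triangles S w : w \in B -> S \subset N w -> 4 * kappa ^ 2 <= #|S| ->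
  #|S| ^ 3 <= 8 * kappa ^ 3 * #|triangles S|.
Proof.
move=> wB SN big_S; rewrite card_triangles.
set E := \sum_(x in S) #|lights x :&: S|.
have dE : #|S| ^ 2 <= kappa * (E + #|S|) := light_density wB SN.
set W := \sum_(x in S) \sum_(y in lights x :&: S) _.
have dW : \sum_(x in S) #|lights x :&: S| ^ 2 <= kappa * (W + E).
  rewrite -big_split big_distrr; apply: leq_sum => x xS /=.
  by apply: (light_density wB); apply: subset_trans (subsetIr _ _) SN.
have sE : E ^ 2 <= #|S| * (kappa * (W + E)).
  exact: leq_trans (sqr_sum_leq S _) (leq_mul (leqnn _) dW).
have kap2 : 2 <= kappa by rewrite leq_addr.
move: (#|S|) (E) (W) kappa big_S dE sE kap2 => n e f k big_S dE sE kap2; clear -big_S dE sE kap2.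
have h1 : n ^ 2 <= 2 * k * e by rewrite -!mulnn in big_S dE *; nia.
have h2 : 2 * k * n <= e.
  have n_gt0 : 0 < n by apply: leq_trans big_S; rewrite -mulnn; nia.
  by rewrite -!mulnn in big_S h1; nia.
have h3 : e ^ 2 <= 2 * n * k * f by rewrite -mulnn in sE *; nia.
have h4 : n ^ 4 <= 8 * k ^ 3 * n * f.
  apply: (@leq_trans ((2 * k * e) ^ 2)).
    by rewrite -[4]/(2 * 2) expnM leq_exp2r.
  rewrite expnMn; apply: leq_trans (leq_mul (leqnn _) h3) _.
  by rewrite !expnS !expn0; nia.
have n_gt0 : 0 < n by apply: leq_trans big_S; rewrite -mulnn; nia.
rewrite -(leq_pmul2l n_gt0) -expnS; apply: leq_trans h4 _.
by rewrite [leqRHS]mulnA [n * (_ * _)]mulnC.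
Qed.

(** One common neighbour for each light pair, chosen once and for all: it
    fixes the path by which y is reached from x. *)
Definition centre x y := odflt x [pick w in common x y].

Lemma centreP x y : y \in lights x -> centre x y \in common x y.
Proof.
rewrite inE => /and3P[_ /card_gt0P[w wc] _]; rewrite /centre.
by case: pickP => [w' //|/(_ w)]; rewrite wc.
Qed.

(** The vertices reached from the three roots by paths with distinct middle
    vertices. *)
Definition clean x1 x2 x3 := [set y | [&& y \in lights x1, y \in lights x2,
  y \in lights x3, centre x1 y != centre x2 y, centre x1 y != centre x3 y
  & centre x2 y != centre x3 y]].

Section Roots.
Variables (x1 x2 x3 : T) (K : nat).
Let X (i : 'I_3) := nth x1 [:: x1; x2; x3] i.
Let fiber (i : 'I_3) v := [set y in clean x1 x2 x3 | centre (X i) y == v].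
Hypothesis fiber_bound : forall i v, #|fiber i v| <= K.

Lemma clean_light y i : y \in clean x1 x2 x3 -> y \in lights (X i).
Proof.
rewrite inE => /and4P[y1 y2 y3 _].
by case: i => [[|[|[|i]]]].
Qed.

Lemma clean_centre_inj y : y \in clean x1 x2 x3 -> injective (fun i => centre (X i) y).
Proof.
rewrite inE => /and5P[_ _ _ n12 /andP[n13 n23]].
move=> [[|[|[|i]]] hi] [[|[|[|j]]] hj] //= /eqP E; apply/val_inj => //=; move: E.
- by rewrite /X /= (negPf n12).
- by rewrite /X /= (negPf n13).
- by rewrite /X /= eq_sym (negPf n12).
- by rewrite /X /= (negPf n23).
- by rewrite /X /= eq_sym (negPf n13).
- by rewrite /X /= eq_sym (negPf n23).
Qed.

Let away := [set y in clean x1 x2 x3 | [forall i, forall j, centre (X i) y != X j]].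
Let clash : rel T := fun y y' => [exists i, [|| centre (X i) y == y',
  centre (X i) y' == y | [exists j, centre (X i) y' == centre (X j) y]]].

Lemma clash_sym : symmetric clash.
Proof.
move=> y y'; apply/existsP/existsP => -[i /or3P[h|h|/existsP[j h]]].
- by exists i; rewrite h orbT.
- by exists i; rewrite h.
- by exists j; apply/or3P/Or33/existsP; exists i; rewrite eq_sym.
- by exists i; rewrite h orbT.
- by exists i; rewrite h.
- by exists j; apply/or3P/Or33/existsP; exists i; rewrite eq_sym.
Qed.

(** If the paths to t vertices avoid each other and the roots, they form a
    forbidden subdivision. The roots are distinct because the middle vertices
    of one path system are. *)
Lemma no_spread_family (l : seq T) : size l = t -> {subset l <= away} ->
  pairwise (fun y y' => ~~ ((y' == y) || clash y y')) l -> False.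
Proof.
move=> size_l sub_l pw_l.
have [y0 y0l] : exists y0, y0 \in l.
  by case: l size_l {sub_l pw_l} t_gt0 => [<-//|y0 l' _ _]; exists y0; rewrite mem_head.
pose y (j : 'I_t) := nth y0 l j; pose w i (j : 'I_t) := centre (X i) (y j).
have y_away j : y j \in away by apply/sub_l/mem_nth; rewrite size_l.
have y_clean j : y j \in clean x1 x2 x3 by have := y_away j; rewrite inE => /andP[].
have wX i i' j : w i j != X i'.
  by have := y_away j; rewrite inE => /andP[_ /forallP/(_ i)/forallP/(_ i')].
have wc i j : [/\ w i j \in B, X i \in N (w i j) & y j \in N (w i j)].
  by apply/mem_common/centreP/clean_light.
have apart j j' : j != j' -> y j != y j' /\ ~~ clash (y j) (y j').
  move=> njj'; have lt (k : 'I_t) : (k : nat) \in [pred n | n < size l] by rewrite inE size_l.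
  have [ltjj'|lej'j] := ltnP j j'.
    have /(pairwiseP y0)/(_ _ _ (lt j) (lt j') ltjj') := pw_l.
    by rewrite negb_or eq_sym => /andP.
  have ltj'j : j' < j by rewrite ltn_neqAle lej'j andbT eq_sym.
  have /(pairwiseP y0)/(_ _ _ (lt j') (lt j) ltj'j) := pw_l.
  by rewrite negb_or clash_sym => /andP.
have unclash i j j' : j != j' -> w i j != y j' /\ forall i', w i j != w i' j'.
  move=> /apart[_ /existsPn nc]; split; first by have := nc i; rewrite negb_or => /andP[].
  move=> i'; have := nc i'; rewrite !negb_or => /and3P[_ _ /existsPn/(_ i)].
  by rewrite eq_sym.
have wy i j j' : w i j != y j'.
  have [<-|/(unclash i)[] //] := eqVneq j j'.
  by have [_ _ yN] := wc i j; apply: contraTneq yN => ->; apply: N_irr.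
apply: theta_free; exists X, y, w; split; last exact: wc.
have j0 : 'I_t := Ordinal t_gt0.
move=> [[i|j]|[i j]] [[i'|j']|[i' j']] /= E.
- by congr (inl (inl _)); apply: (clean_centre_inj (y_clean j0)); rewrite /= E.
- have := clean_light i (y_clean j'); rewrite inE => /light_neq.
  by rewrite E eqxx.
- by have := wX i' i j'; rewrite E eqxx.
- have := clean_light i' (y_clean j); rewrite inE => /light_neq.
  by rewrite E eqxx.
- by have [->//|/apart[]] := eqVneq j j'; rewrite E eqxx.
- by have := wy i' j' j; rewrite E eqxx.
- by have := wX i i' j; rewrite E eqxx.
- by have := wy i j j'; rewrite E eqxx.
- have [ejj'|njj'] := eqVneq j j'; last first.
    by have [_ /(_ i')] := unclash i _ _ njj'; rewrite E eqxx.
  by rewrite -ejj' in E *; rewrite (clean_centre_inj (y_clean j) E).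
Qed.

Lemma closed_nbhd_clash y : #|closed_nbhd clash away y| <= 4 + 12 * K.
Proof.
pose C (i : 'I_3) :=
  centre (X i) y |: (fiber i y :|: \bigcup_j fiber i (centre (X j) y)).
apply: leq_trans (_ : #|[set y]| + \sum_i #|C i| <= _).
  apply: leq_card_cover => y' /setIdP[y'a /orP[/eqP->|/existsP[i]]].
    by left; rewrite inE.
  have y'c : y' \in clean x1 x2 x3 by case/setIdP: y'a.
  move=> h; right; exists i; rewrite /C in_setU1 in_setU [y' \in fiber _ _]in_set y'c.
  case/or3P: h => [/eqP->|->|/existsP[j h]]; rewrite ?eqxx ?orbT //.
  by apply/orP; right; apply/orP; right; apply/bigcupP; exists j => //; apply/setIdP.
have bC i : #|C i| <= 1 + 4 * K.
  rewrite cardsU1; apply: leq_add; first by case: (_ \notin _).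
  apply: leq_trans (leq_card_setU _ _) _; rewrite -[4]/(1 + 3) mulnDl mul1n.
  apply: leq_add => //; apply: leq_trans (_ : #|@set0 T| + \sum_(j < 3) K <= _).
    apply: leq_trans (_ : #|@set0 T| + \sum_j #|fiber i (centre (X j) y)| <= _).
      by apply: leq_card_cover => z /bigcupP[j _ zj]; right; exists j.
    by rewrite leq_add2l; apply: leq_sum.
  by rewrite cards0 sum_nat_const card_ord.
rewrite cards1; apply: leq_trans (_ : 1 + \sum_(i < 3) (1 + 4 * K) <= _).
  by rewrite leq_add2l; apply: leq_sum.
by rewrite sum_nat_const card_ord mulnDr mulnA.
Qed.

(** If no middle vertex serves more than K of the vertices y, then all but 9 K
    of them are reached by paths that avoid the roots, and each of these
    clashes with at most 4 + 12 K of them, itself included. By Turan's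
    theorem, t of them do not clash with one another if there are too many. *)
Lemma clean_bound : #|clean x1 x2 x3| <= t * (4 + 21 * K).
Proof.
have away_bound : #|away| <= t * (4 + 12 * K).
  have [[l [size_l sub_l pw_l]]|] := @turan_independent _ clash t.-1 away.
    by case: (no_spread_family _ sub_l pw_l); rewrite size_l prednK.
  have : \sum_(y in away) #|closed_nbhd clash away y| <= #|away| * (4 + 12 * K).
    by rewrite -sum_nat_const; apply: leq_sum => y _; apply: closed_nbhd_clash.
  move: (\sum_(y in away) _) => s; have [->//|a_gt0] := posnP #|away|.
  move=> le_s le_a; rewrite -(leq_pmul2l a_gt0) mulnn; apply: leq_trans le_a _.
  by rewrite mulnCA; apply: leq_mul; rewrite ?leq_pred.
pose C (ij : 'I_3 * 'I_3) := fiber ij.1 (X ij.2).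
apply: leq_trans (_ : #|away| + \sum_ij #|C ij| <= _).
  apply: leq_card_cover => y yc; have [ya|] := boolP (y \in away); first by left.
  rewrite in_set yc /= => /forallPn[i /forallPn[j]]; rewrite negbK => h.
  by right; exists (i, j); apply/setIdP.
apply: (@leq_trans (t * (4 + 12 * K) + \sum_(ij : 'I_3 * 'I_3) K)).
  by apply: leq_add => //; apply: leq_sum => ij _; apply: fiber_bound.
rewrite sum_nat_const card_prod card_ord; move: t_gt0; clear; nia.
Qed.

End Roots.

Lemma clean_fiber x1 x2 x3 x y v : (x = x1 \/ x = x2 \/ x = x3) ->
  y \in clean x1 x2 x3 -> centre x y == v -> [/\ v \in B, x \in N v & y \in N v].
Proof.
move=> ex yc /eqP <-; apply/mem_common/centreP; move: yc; rewrite inE.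
by case/and4P => y1 y2 y3 _; case: ex => [->|[->|->]].
Qed.

Lemma same_centre_bound x x' : light x x' ->
  #|[set z in lights x :&: lights x' | centre x z == centre x' z]| <= heavy_bound * D.
Proof.
move=> /and3P[_ _ lt_c].
pose C w := if w \in common x x' then N w else set0.
apply: leq_trans (_ : #|@set0 T| + \sum_w #|C w| <= _).
  apply: leq_card_cover => z; rewrite !inE => /andP[/andP[xz x'z] /eqP E].
  right; exists (centre x z); rewrite /C.
  have [wB xw zw] := mem_common (centreP (etrans (in_set _ _) xz)).
  have [_ x'w _] := mem_common (centreP (etrans (in_set _ _) x'z)).
  by rewrite (_ : _ \in common x x') // inE wB xw E x'w.
rewrite cards0 add0n (bigID (mem (common x x'))) /= [X in _ + X]big1 ?addn0; last first.
  by move=> w /negPf nw; rewrite /C nw cards0.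
rewrite (eq_bigr (fun _ => D)); last first.
  by move=> w wc; rewrite /C wc card_N //; have [] := mem_common wc.
by rewrite sum_nat_const leq_mul2r ltnW ?orbT.
Qed.

Definition triangle_bound := 25 * t + 3 * heavy_bound.

(** A middle vertex serves at most D vertices, so [clean_bound] applies with K
    = D. Vertices that are not clean are adjacent to a common neighbour of two
    of the roots, and a light pair has boundedly many. *)
Lemma triangle_codegree x1 x2 x3 : 0 < D -> light x1 x2 -> light x1 x3 -> light x2 x3 ->
  #|lights x1 :&: (lights x2 :&: lights x3)| <= triangle_bound * D.
Proof.
move=> D_gt0 l12 l13 l23.
pose bad x x' := [set z in lights x :&: lights x' | centre x z == centre x' z].
have cov : #|lights x1 :&: (lights x2 :&: lights x3)| <=
    #|clean x1 x2 x3| + (#|bad x1 x2| + #|bad x1 x3| + #|bad x2 x3|).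
  apply: leq_trans (_ : #|clean x1 x2 x3 :|: (bad x1 x2 :|: bad x1 x3 :|: bad x2 x3)| <= _).
    apply/subset_leq_card/subsetP => z; rewrite !inE => /and3P[-> -> ->] /=.
    by do 3!case: (_ == _).
  apply: leq_trans (leq_card_setU _ _) _; rewrite leq_add2l.
  apply: leq_trans (leq_card_setU _ _) _; rewrite leq_add2r.
  exact: leq_card_setU.
apply: leq_trans cov _.
have := same_centre_bound l12; have := same_centre_bound l13; have := same_centre_bound l23.
rewrite -!/(bad _ _).
have : #|clean x1 x2 x3| <= t * (4 + 21 * D).
  apply: clean_bound => i v; have [->|[y]] := set_0Vmem
    [set y in clean x1 x2 x3 | centre (nth x1 [:: x1; x2; x3] i) y == v].
    by rewrite cards0.
  have ex : let x := nth x1 [:: x1; x2; x3] i in x = x1 \/ x = x2 \/ x = x3.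
    by case: i => [[|[|[|i]]]] //=; tauto.
  case/setIdP => yc /(clean_fiber ex yc)[vB _ _]; rewrite -(card_N vB).
  by apply/subset_leq_card/subsetP => z /setIdP[zc /(clean_fiber ex zc)[]].
rewrite /triangle_bound; move: (#|_|) (#|_|) (#|_|) (#|_|) heavy_bound t_gt0 D_gt0.
by move=> a b c d h; clear; nia.
Qed.

Definition joint w p r := #|N w :&: (lights p :&: lights r)|.
(** The vertices of N w light to both p and r, counted only if there are more
    than M of them: these w are the middle vertices on which the paths to p, r
    and a third root concentrate. *)
Definition rich M w p r := if M < joint w p r then joint w p r else 0.
Definition rich_at M x p r := \sum_(w in B | x \in N w) rich M w p r.
Definition richness M := \sum_p \sum_r \sum_(w in B) rich M w p r.

Lemma joint_le_rich M x w p r : w \in B -> x \in N w ->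
  joint w p r <= M + rich_at M x p r.
Proof.
move=> wB xw; rewrite /rich_at (bigD1 w) /= ?wB // addnA.
apply: leq_trans (leq_addr _ _); rewrite /rich; case: ltnP => [_|le_M].
  exact: leq_addl.
by rewrite addn0.
Qed.

(** A middle vertex v next to one root serves at most [joint v p r] clean
    vertices, where p and r are the other two roots. *)
Lemma clean_le_rich M x1 x2 x3 : #|clean x1 x2 x3| <=
  t * (4 + 21 * (M + (rich_at M x1 x2 x3 + rich_at M x2 x1 x3 + rich_at M x3 x1 x2))).
Proof.
apply: clean_bound => i v.
have [->|[y]] := set_0Vmem
  [set y in clean x1 x2 x3 | centre (nth x1 [:: x1; x2; x3] i) y == v].
  by rewrite cards0.
set x := nth x1 _ i => /setIdP[yc yv].
have ex : x = x1 \/ x = x2 \/ x = x3.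
  by rewrite /x; case: i x yv => [[|[|[|i]]]] //=; tauto.
have [vB xv _] := clean_fiber ex yc yv.
have sub p r : (forall z, z \in clean x1 x2 x3 -> z \in lights p /\ z \in lights r) ->
    #|[set z in clean x1 x2 x3 | centre x z == v]| <= joint v p r.
  move=> lpr; apply/subset_leq_card/subsetP => z /setIdP[zc zv].
  have [_ _ zN] := clean_fiber ex zc zv.
  by have [zp zr] := lpr z zc; rewrite in_setI zN in_setI zp.
have cl z : z \in clean x1 x2 x3 -> [/\ z \in lights x1, z \in lights x2 & z \in lights x3].
  by rewrite inE => /and4P[].
have [e|[e|e]] := ex; rewrite e in xv.
- apply: leq_trans (sub x2 x3 _) _; first by move=> z /cl[].
  apply: leq_trans (joint_le_rich M x2 x3 vB xv) _.
  by rewrite leq_add2l -addnA leq_addr.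
- apply: leq_trans (sub x1 x3 _) _; first by move=> z /cl[].
  apply: leq_trans (joint_le_rich M x1 x3 vB xv) _.
  by rewrite leq_add2l addnAC leq_addl.
- apply: leq_trans (sub x1 x2 _) _; first by move=> z /cl[].
  apply: leq_trans (joint_le_rich M x1 x2 vB xv) _.
  by rewrite leq_add2l leq_addl.
Qed.

Lemma sum_rich_at M : \sum_p \sum_r \sum_x rich_at M x p r = D * richness M.
Proof.
rewrite /richness big_distrr; apply: eq_bigr => p _; rewrite big_distrr.
apply: eq_bigr => r _; rewrite /rich_at /= big_distrr /=.
under eq_bigr do rewrite big_mkcondr /=.
rewrite exchange_big /=; apply: eq_bigr => w wB.
by rewrite -big_mkcond /= sum_nat_const card_N.
Qed.

Lemma sum_clean M : \sum_x1 \sum_x2 \sum_x3 #|clean x1 x2 x3| <=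
  t * (4 * #|T| ^ 3 + 21 * (M * #|T| ^ 3 + 3 * (D * richness M))).
Proof.
apply: (@leq_trans (\sum_x1 \sum_x2 \sum_x3 t * (4 + 21 * (M +
   (rich_at M x1 x2 x3 + rich_at M x2 x1 x3 + rich_at M x3 x1 x2))))).
  by do 3![apply: leq_sum => ? _]; apply: clean_le_rich.
have const c : \sum_(x1 : T) \sum_(x2 : T) \sum_(x3 : T) c = c * #|T| ^ 3.
  by rewrite !sum_nat_const !cardT -!cardE !expnS expn0 muln1 !mulnA mulnC !mulnA.
have S1 : \sum_x1 \sum_x2 \sum_x3 rich_at M x1 x2 x3 = D * richness M.
  rewrite exchange_big -sum_rich_at; apply: eq_bigr => p _.
  exact: exchange_big.
have S2 : \sum_x1 \sum_x2 \sum_x3 rich_at M x2 x1 x3 = D * richness M.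
  by rewrite -sum_rich_at; apply: eq_bigr => p _; apply: exchange_big.
have S3 : \sum_x1 \sum_x2 \sum_x3 rich_at M x3 x1 x2 = D * richness M.
  exact: sum_rich_at.
have pull (f : T -> T -> T -> nat) c : \sum_x1 \sum_x2 \sum_x3 c * f x1 x2 x3 =
    c * \sum_x1 \sum_x2 \sum_x3 f x1 x2 x3.
  by do 3![rewrite big_distrr /=; apply: eq_bigr => ? _].
have split (f g : T -> T -> T -> nat) : \sum_x1 \sum_x2 \sum_x3 (f x1 x2 x3 + g x1 x2 x3) =
    \sum_x1 \sum_x2 \sum_x3 f x1 x2 x3 + \sum_x1 \sum_x2 \sum_x3 g x1 x2 x3.
  by do 3![rewrite -big_split /=; apply: eq_bigr => ? _].
rewrite pull split const pull split const !split S1 S2 S3.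
by rewrite (_ : forall a, a + a + a = 3 * a) // => a; rewrite !mulSn mul0n addn0 addnA.
Qed.

(** A large set N w of vertices light to p and r contains a number of light
    triangles cubic in its size, which gains the factor M^2. Summed over p and
    r, each triangle in N w is counted with the square of the number of
    vertices light to its three vertices. *)
Lemma richness_bound M : 0 < D -> 4 * kappa ^ 2 <= M ->
  M ^ 2 * richness M <= 8 * kappa ^ 3 * (#|B| * (D ^ 3 * (triangle_bound * D) ^ 2)).
Proof.
move=> D_gt0 big_M.
have step w p r : w \in B -> M ^ 2 * rich M w p r <=
    8 * kappa ^ 3 * #|triangles (N w :&: (lights p :&: lights r))|.
  move=> wB; rewrite /rich; case: ltnP => [lt_M|_]; last by rewrite muln0.
  apply: leq_trans (many_triangles wB (subsetIl _ _) _); last first.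
    exact: leq_trans big_M (ltnW lt_M).
  by rewrite -/(joint _ _ _) [leqRHS]expnSr leq_mul2r leq_exp2r // ltnW // orbT.
have count w : w \in B ->
    \sum_p \sum_r #|triangles (N w :&: (lights p :&: lights r))| <=
    D ^ 3 * (triangle_bound * D) ^ 2.
  move=> wB; pose on p (y : T * T * T) := [&& light p y.1.1, light p y.1.2 & light p y.2].
  have -> : \sum_p \sum_r #|triangles (N w :&: (lights p :&: lights r))| =
      \sum_(y in triangles (N w)) (\sum_p on p y) ^ 2.
    transitivity (\sum_p \sum_r \sum_(y in triangles (N w)) on p y * on r y).
      apply: eq_bigr => p _; apply: eq_bigr => r _.
      rewrite -sum1_card big_mkcond [RHS]big_mkcond; apply: eq_bigr => -[[a b] c] _.
      rewrite /on !inE /=; do 3!case: (_ \in N w); rewrite ?andbF //=.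
      by do 6!case: (light _ _); rewrite ?andbF //; do 3!case: (light _ _).
    rewrite (eq_bigr _ (fun p _ => exchange_big _ _ _ _ _ _)) exchange_big.
    apply: eq_bigr => y _; rewrite expnS expn1 big_distrl; apply: eq_bigr => p _ /=.
    by rewrite big_distrr.
  apply: leq_trans (_ : \sum_(y in triangles (N w)) (triangle_bound * D) ^ 2 <= _).
    apply: leq_sum => -[[a b] c]; rewrite inE /= => /and5P[_ _ _ lab /andP[lac lbc]].
    rewrite leq_exp2r //; apply: leq_trans (triangle_codegree D_gt0 lab lac lbc).
    rewrite -sum1_card [leqRHS]big_mkcond; apply: leq_sum => p _.
    by rewrite /on !inE /= ![light p _]light_sym; do 3!case: (light _ p).
  rewrite sum_nat_const leq_mul2r; apply/orP; right.
  have -> : D ^ 3 = #|setX (setX (N w) (N w)) (N w)|.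
    by rewrite !cardsX card_N // !expnS expn0 muln1 mulnA.
  apply/subset_leq_card/subsetP => -[[a b] c]; rewrite !inE /=.
  by case/and5P => -> -> ->.
rewrite /richness big_distrr /=.
apply: leq_trans (_ : \sum_p \sum_r \sum_(w in B) 8 * kappa ^ 3 *
    #|triangles (N w :&: (lights p :&: lights r))| <= _).
  apply: leq_sum => p _; rewrite big_distrr; apply: leq_sum => r _ /=.
  by rewrite big_distrr; apply: leq_sum => w wB; apply: step.
rewrite (eq_bigr _ (fun p _ => exchange_big _ _ _ _ _ _)) exchange_big /=.
rewrite -sum_nat_const big_distrr /=; apply: leq_sum => w wB.
apply: leq_trans (_ : 8 * kappa ^ 3 * \sum_p \sum_r
    #|triangles (N w :&: (lights p :&: lights r))| <= _).
  by rewrite big_distrr; apply: leq_sum => p _ /=; rewrite big_distrr.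
by rewrite leq_mul2l count ?orbT.
Qed.

(** For each y, few triples of vertices light to y fail to be clean: two of
    them would share the middle vertex, which leaves D choices for the second
    one. *)
Lemma cube_lights_at y : #|lights y| ^ 3 <=
  \sum_x1 \sum_x2 \sum_x3 (y \in clean x1 x2 x3) + 3 * (#|lights y| ^ 2 * D).
Proof.
pose c x := centre x y; pose L x := (x \in lights y).
have inL x : L x = (y \in lights x) by rewrite /L !inE light_sym.
have pairs x : L x -> \sum_(x' | L x') (c x == c x') <= D.
  move=> Lx; have Lx' : y \in lights x by rewrite -inL.
  have [wB _ _] := mem_common (centreP Lx').
  rewrite -(card_N wB) -sum1_card [leqRHS]big_mkcond [leqLHS]big_mkcond; apply: leq_sum => x' _.
  case Lx2: (L x') => //; case: eqP => // E.
  by rewrite inL in Lx2; have [_ + _] := mem_common (centreP Lx2); rewrite -/(c x') -E => ->.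
have cubeE : #|lights y| ^ 3 = \sum_(x1 | L x1) \sum_(x2 | L x2) \sum_(x3 | L x3) 1.
  have sL a : \sum_(x | L x) a = #|lights y| * a by rewrite -sum_nat_const.
  by rewrite !sL muln1 !expnS expn0 muln1.
have le1 x1 x2 x3 : L x1 -> L x2 -> L x3 ->
    1 <= (y \in clean x1 x2 x3) + ((c x1 == c x2) + (c x1 == c x3) + (c x2 == c x3)).
  rewrite !inL => y1 y2 y3; rewrite inE y1 y2 y3 /= -!/(c _).
  by do 3!case: (_ == _).
have bound (f : T -> T -> T -> nat) : \sum_(x1 | L x1) \sum_(x2 | L x2) \sum_(x3 | L x3) f x1 x2 x3 <=
    \sum_x1 \sum_x2 \sum_x3 f x1 x2 x3.
  rewrite big_mkcond; apply: leq_sum => x1 _; case: (L x1) => //.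
  rewrite big_mkcond; apply: leq_sum => x2 _; case: (L x2) => //.
  by rewrite big_mkcond; apply: leq_sum => x3 _; case: (L x3).
rewrite cubeE; apply: leq_trans (_ : \sum_(x1 | L x1) \sum_(x2 | L x2) \sum_(x3 | L x3)
    ((y \in clean x1 x2 x3) + ((c x1 == c x2) + (c x1 == c x3) + (c x2 == c x3))) <= _).
  by apply: leq_sum => x1 L1; apply: leq_sum => x2 L2; apply: leq_sum => x3 L3; apply: le1.
have split (f g : T -> T -> T -> nat) :
    \sum_(x1 | L x1) \sum_(x2 | L x2) \sum_(x3 | L x3) (f x1 x2 x3 + g x1 x2 x3) =
    \sum_(x1 | L x1) \sum_(x2 | L x2) \sum_(x3 | L x3) f x1 x2 x3 +
    \sum_(x1 | L x1) \sum_(x2 | L x2) \sum_(x3 | L x3) g x1 x2 x3.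
  by do 3![rewrite -big_split /=; apply: eq_bigr => ? _].
rewrite !split leq_add ?bound // -[3]/(1 + 1 + 1) !mulnDl !mul1n.
have sL a : \sum_(x | L x) a = #|lights y| * a by rewrite -sum_nat_const.
have cap (f : T -> T -> nat) : (forall x1, L x1 -> \sum_(x2 | L x2) f x1 x2 <= #|lights y| * D) ->
    \sum_(x1 | L x1) \sum_(x2 | L x2) f x1 x2 <= #|lights y| ^ 2 * D.
  move=> capf; apply: leq_trans (_ : \sum_(x1 | L x1) #|lights y| * D <= _).
    exact: leq_sum.
  by rewrite sL mulnA mulnn.
apply: leq_add; first apply: leq_add.
- apply: cap => x1 L1; under eq_bigr do rewrite sL.
  by rewrite -big_distrr leq_mul2l pairs ?orbT.
- apply: cap => x1 L1; rewrite sL leq_mul2l pairs ?orbT //.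
- apply: cap => x1 L1; rewrite -sL; apply: leq_sum => x2 L2; exact: pairs.
Qed.

Lemma cube_lights : \sum_y #|lights y| ^ 3 <=
  2 * \sum_x1 \sum_x2 \sum_x3 #|clean x1 x2 x3| + 216 * (#|T| * D ^ 3).
Proof.
have -> : \sum_x1 \sum_x2 \sum_x3 #|clean x1 x2 x3| =
    \sum_y \sum_x1 \sum_x2 \sum_x3 (y \in clean x1 x2 x3).
  transitivity (\sum_x1 \sum_y \sum_x2 \sum_x3 (y \in clean x1 x2 x3)); last exact: exchange_big.
  apply: eq_bigr => x1 _; rewrite [RHS]exchange_big; apply: eq_bigr => x2 _ /=.
  rewrite [RHS]exchange_big; apply: eq_bigr => x3 _ /=.
  by rewrite -sum1_card big_mkcond; apply: eq_bigr => y _; case: (_ \in _).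
rewrite -sum_nat_const !big_distrr -big_split; apply: leq_sum => y _ /=.
have := cube_lights_at y; move: (\sum_x1 _) (#|lights y|) => s l; clear.
have -> : l ^ 3 = l ^ 2 * l by rewrite -expnSr.
have -> : D ^ 3 = D ^ 2 * D by rewrite -expnSr.
have [le_l|lt_l] := leqP l (6 * D).
  have : l ^ 2 <= 36 * D ^ 2 by rewrite -[36]/(6 ^ 2) -expnMn leq_exp2r.
  by move: (l ^ 2) (D ^ 2) => a b; nia.
have : l ^ 2 * (6 * D) <= l ^ 2 * l by rewrite leq_mul2l ltnW ?orbT.
by move: (l ^ 2) (D ^ 2) => a b; nia.
Qed.

End Core.

(** * Upper bound for the number of edges *)

(** The threshold M is a large multiple of n / m. With that choice the
    contribution e m D^6 / M^2 of rich middle vertices is at most half of the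
    left hand side of the first hypothesis, and the remaining terms give the
    bound. *)
Lemma counting_arithmetic (a e t M0 : nat) : exists C0, forall n m D T3 C,
  0 < m -> m <= n ->
  m ^ 3 * D ^ 6 <= a * (n ^ 2 * T3) -> T3 <= 2 * C + 216 * (n * D ^ 3) ->
  (forall M, M0 <= M -> exists G,
     C <= t * (4 * n ^ 3 + 21 * (M * n ^ 3 + 3 * G)) /\ M ^ 2 * G <= e * (m * D ^ 6)) ->
  m ^ 2 * D ^ 3 <= C0 * n ^ 3.
Proof.
pose s := (M0 + 252 * a * t * e).+1; pose b := 200 * a * t * s + 432 * a.
exists (2 * b) => n m D T3 C m_gt0 le_mn H1 H2 H3.
(* M lies between s n / m and 2 s n / m. *)
pose M := s * (n %/ m).+1.
have snM : s * n <= m * M.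
  rewrite /M mulnCA leq_mul2l; apply/orP; right; rewrite mulnC ltnW //.
  exact: ltn_ceil.
have mMs : m * M <= 2 * s * n.
  rewrite /M mulnCA -mulnA [leqRHS]mulnCA leq_mul2l; apply/orP; right.
  rewrite mulnS mulnC; apply: leq_trans (leq_add le_mn (leq_trunc_div n m)) _.
  by rewrite addnn mul2n.
have M_gt0 : 0 < M by rewrite muln_gt0.
have M0M : M0 <= M.
  apply: leq_trans (_ : s <= _); last by rewrite leq_pmulr.
  by rewrite ltnW // ltnS leq_addr.
have s2 : 252 * a * t * e <= s ^ 2.
  apply: leq_trans (_ : s <= _); first by rewrite ltnW // ltnS leq_addl.
  by rewrite -mulnn leq_pmulr.
have [G [HC HG]] := H3 M M0M.
have E1 : m ^ 3 * D ^ 6 <= a * (n ^ 2 * (50 * t * M * n ^ 3 + 126 * t * G + 216 * (n * D ^ 3))).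
  apply: leq_trans H1 _; rewrite !leq_mul2l; do 2![apply/orP; right].
  apply: leq_trans H2 _; rewrite leq_add2r.
  apply: leq_trans (leq_mul (leqnn 2) HC) _.
  move: (n ^ 3) M_gt0; clear; nia.
have E2 : 252 * a * t * (n ^ 2 * (M ^ 2 * G)) <= M ^ 2 * (m ^ 3 * D ^ 6).
  apply: leq_trans (_ : 252 * a * t * (n ^ 2 * (e * (m * D ^ 6))) <= _).
    by rewrite !leq_mul2l HG !orbT.
  apply: leq_trans (_ : (s * n) ^ 2 * (m * D ^ 6) <= _).
    rewrite expnMn; move: (n ^ 2) (m * D ^ 6) (s ^ 2) s2; clear => x y z le_z.
    apply: leq_trans (_ : (252 * a * t * e) * (x * y) <= _); first by rewrite eq_leq //; ring.
    by rewrite -[leqRHS]mulnA leq_mul2r le_z orbT.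
  apply: leq_trans (_ : (m * M) ^ 2 * (m * D ^ 6) <= _).
    by rewrite leq_mul2r leq_exp2r // snM orbT.
  by rewrite eq_leq //; ring.
have E3 : m ^ 3 * D ^ 6 <= a * (n ^ 2 * (100 * t * M * n ^ 3 + 432 * (n * D ^ 3))).
  have : 0 < M ^ 2 by rewrite expn_gt0 M_gt0.
  move=> M2_gt0; rewrite -(leq_pmul2l M2_gt0) -(leq_add2l (M ^ 2 * (m ^ 3 * D ^ 6))).
  apply: leq_trans (_ : 2 * M ^ 2 * (a * (n ^ 2 * (50 * t * M * n ^ 3 + 126 * t * G
    + 216 * (n * D ^ 3)))) <= _).
    by rewrite addnn -mul2n -mulnA !leq_mul2l E1 !orbT.
  apply: leq_trans (_ : 252 * a * t * (n ^ 2 * (M ^ 2 * G)) +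
      M ^ 2 * (a * (n ^ 2 * (100 * t * M * n ^ 3 + 432 * (n * D ^ 3)))) <= _).
    by rewrite eq_leq //; ring.
  by rewrite leq_add2r.
pose X := m ^ 2 * D ^ 3.
have E4 : X ^ 2 <= b * (n ^ 6 + n ^ 3 * X).
  have -> : X ^ 2 = m * (m ^ 3 * D ^ 6) by rewrite /X; ring.
  apply: leq_trans (leq_mul (leqnn m) E3) _.
  apply: leq_trans (_ : 100 * a * t * n ^ 5 * (m * M) + 432 * a * n ^ 3 * (m * D ^ 3) <= _).
    by rewrite eq_leq //; ring.
  apply: leq_trans (_ : 100 * a * t * n ^ 5 * (2 * s * n) + 432 * a * n ^ 3 * X <= _).
    apply: leq_add; first by rewrite leq_mul2l mMs orbT.
    by rewrite leq_mul2l leq_mul2r -mulnn leq_pmulr ?orbT.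
  apply: leq_trans (_ : 200 * a * t * s * (n ^ 6 + n ^ 3 * X) + 432 * a * (n ^ 6 + n ^ 3 * X) <= _).
    apply: leq_add; last by rewrite -mulnA leq_mul2l leq_addl orbT.
    apply: leq_trans (_ : 200 * a * t * s * n ^ 6 <= _); first by rewrite eq_leq //; ring.
    by rewrite leq_mul2l leq_addr orbT.
  by rewrite -mulnDl.
rewrite -/X leqNgt; apply/negP => lt_X.
have n3 : n ^ 6 = n ^ 3 * n ^ 3 by rewrite -expnD.
rewrite n3 in E4; have n_gt0 : 0 < n ^ 3 by rewrite expn_gt0 (leq_trans m_gt0).
move: (n ^ 3) X b n_gt0 lt_X E4; clear => y x c y_gt0 lt_x; rewrite -mulnn.
have [->|c_gt0] := posnP c; nia.
Qed.

(** Keeping only D neighbours of each vertex of degree at least D puts the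
    graph into the regular setting above. *)
Theorem high_degree_count (t : nat) : 0 < t -> exists C0 D0, 0 < D0 /\
  forall (T : finType) (G : sgraph T) D,
  ~~ contains G (subdivision (Kst 3 t)) -> D0 <= D ->
  #|[set w | D <= #|nbrs G w|]| ^ 2 * D ^ 3 <= C0 * #|T| ^ 3.
Proof.
move=> t_gt0; pose k := kappa t; pose h := heavy_bound t.
have [C0 arith] := counting_arithmetic ((2 * k * h) ^ 3)
  (8 * k ^ 3 * triangle_bound t ^ 2) t (4 * k ^ 2).
exists C0, (2 * k); split=> // T G D freeG le_D.
set B := [set w | _].
have D_gt0 : 0 < D by apply: leq_trans le_D.
have [B0|B_gt0] := posnP #|B|; first by rewrite B0.
pose N w := [set x in take D (enum (nbrs G w))].
have subN w : N w \subset nbrs G w.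
  by apply/subsetP => x; rewrite inE => /mem_take; rewrite mem_enum.
have card_N w : w \in B -> #|N w| = D.
  rewrite inE => le_w; rewrite cardsE (card_uniqP _) ?take_uniq ?enum_uniq //.
  by rewrite size_take_min -cardE (minn_idPl le_w).
have N_irr w : w \notin N w.
  apply/negP => /(subsetP (subN w)); rewrite inE => /adj_neq.
  by rewrite eqxx.
have free : ~ exists (x : 'I_3 -> T) (y : 'I_t -> T) (w : 'I_3 -> 'I_t -> T),
    injective (assemble x y w) /\
    forall i j, [/\ w i j \in B, x i \in N (w i j) & y j \in N (w i j)].
  case=> x [y [w [inj_a xyw]]]; case/negP: freeG; apply/contains_subdivisionP.
  exists x, y, w; split=> // i j; have [_ xw yw] := xyw i j.
  have := subsetP (subN _) _ xw; have := subsetP (subN _) _ yw; rewrite !inE.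
  by rewrite [adj G (x i) _]adj_sym.
have le_B : #|B| <= #|T| by apply: max_card.
apply: (arith _ _ _ (\sum_x #|lights B N t x| ^ 3)
  (\sum_x1 \sum_x2 \sum_x3 #|clean B N t x1 x2 x3|)) => //.
- have H := many_light card_N t_gt0 free le_D.
  apply: leq_trans (_ : ((2 * k * h) * \sum_x #|lights B N t x|) ^ 3 <= _).
    by rewrite -[6]/(2 * 3) expnM -expnMn leq_exp2r.
  by rewrite expnMn leq_mul2l cube_sum_leq orbT.
- exact: cube_lights.
move=> M le_M; exists (D * richness B N t M); split.
  exact: sum_clean.
have := richness_bound card_N N_irr t_gt0 free D_gt0 le_M => H.
rewrite mulnCA; apply: leq_trans (leq_mul (leqnn D) H) _.
by rewrite eq_leq // -/k; ring.
Qed.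

Lemma dyadic_bound (q d J : nat) : d < q * 4 ^ J ->
  d <= q + \sum_(j < J) (q * 4 ^ j <= d) * (q * 4 ^ j.+1).
Proof.
elim: J => [|J IHJ]; first by rewrite muln1 => /ltnW lt_d; rewrite big_ord0 addn0.
move=> lt_d; rewrite big_ord_recr /=; have [le_d|/IHJ le_d] := leqP (q * 4 ^ J) d.
  by rewrite addnA mul1n (leq_trans (ltnW lt_d)) // leq_addl.
by rewrite mul0n addn0.
Qed.

(** The induction proves the bound 2 A (1 - 1 / 2^J), multiplied by 2^J. *)
Lemma geometric_sum (a : nat -> nat) A J : (forall j, a j * 2 ^ j <= A) ->
  \sum_(j < J) a j <= 2 * A.
Proof.
move=> le_a; have pow_gt0 n : 0 < 2 ^ n by rewrite expn_gt0.
rewrite -(leq_pmul2r (pow_gt0 J)); apply: leq_trans (_ : 2 * A * (2 ^ J - 1) <= _); last first.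
  by rewrite leq_mul2l leq_subr orbT.
elim: J => [|J IHJ]; first by rewrite big_ord0.
rewrite big_ord_recr mulnDl /= expnS; have := le_a J; have := pow_gt0 J.
by move: (2 ^ J) (a J) (\sum_(j < J) _) IHJ => p x s; clear; nia.
Qed.

(** Vertices of degree below q contribute at most n q <= q^4. There are O(q^3
    / 8^j) vertices of degree at least q 4^j, so those of degree about q 4^j
    contribute O(q^4 / 2^j). *)
Lemma degree_sum_bound (t : nat) : 0 < t -> exists C1 D0, 0 < D0 /\
  forall (T : finType) (G : sgraph T) q,
  ~~ contains G (subdivision (Kst 3 t)) -> D0 <= q -> #|T| <= q ^ 3 ->
  \sum_x #|nbrs G x| <= C1 * q ^ 4.
Proof.
move=> t_gt0; have [C0 [D0 [D0_gt0 HD]]] := high_degree_count t_gt0.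
exists (1 + 8 * C0), D0; split=> // T G q freeG le_q le_T.
have q_gt0 : 0 < q by apply: leq_trans le_q.
pose m j := #|[set w | q * 4 ^ j <= #|nbrs G w|]|.
have le_m j : m j * 4 ^ j * 2 ^ j <= C0 * q ^ 3.
  have pow_gt0 : 0 < 4 ^ j by rewrite expn_gt0.
  have H := HD T G (q * 4 ^ j) freeG (leq_trans le_q (leq_pmulr _ pow_gt0)).
  rewrite -leq_sqr; apply: leq_trans (_ : C0 * q ^ 6 <= _); last first.
    rewrite expnMn -[6]/(3 * 2) expnM leq_mul2r -mulnn.
    by case: (C0) => [|c]; rewrite ?orbT // leq_pmulr ?orbT.
  have q3_gt0 : 0 < q ^ 3 by rewrite expn_gt0 q_gt0.
  rewrite -(leq_pmul2r q3_gt0) -[leqRHS]mulnA -expnD.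
  apply: leq_trans (_ : C0 * #|T| ^ 3 <= _); last first.
    by rewrite leq_mul2l -[6 + 3]/(3 * 3) expnM leq_exp2r // le_T orbT.
  apply: leq_trans H; rewrite -/(m j) eq_leq // !expnMn -[4 ^ j]/((2 * 2) ^ j) expnMn.
  by ring.
pose J := #|T|.
have lt_deg w : #|nbrs G w| < q * 4 ^ J.
  apply: leq_ltn_trans (max_card _) _; apply: leq_trans (ltn_expl J (isT : 1 < 4)) _.
  by rewrite leq_pmull.
apply: (@leq_trans (\sum_w (q + \sum_(j < J) (q * 4 ^ j <= #|nbrs G w|) * (q * 4 ^ j.+1)))).
  by apply: leq_sum => w _; apply: dyadic_bound.
rewrite big_split /= sum_nat_const exchange_big /= mulnDl mul1n.
apply: leq_add; first by rewrite expnSr leq_mul2r le_T orbT.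
apply: (@leq_trans (\sum_(j < J) 4 * q * (m j * 4 ^ j))).
  apply: leq_sum => j _; rewrite -big_distrl /= expnS.
  have -> : \sum_w (q * 4 ^ j <= #|nbrs G w|) = m j.
    rewrite /m -sum1_card big_mkcond [RHS]big_mkcond; apply: eq_bigr => w _.
    by rewrite inE; case: (_ <= _).
  by rewrite eq_leq //; ring.
rewrite -big_distrr /=; apply: leq_trans (leq_mul (leqnn _) (geometric_sum _ le_m)) _.
by rewrite eq_leq // expnSr; ring.
Qed.

Lemma turan_upper (t : nat) : 0 < t -> exists C1 D0, 0 < D0 /\
  forall n q, D0 <= q -> n <= q ^ 3 ->
  (turan n (subdivision (Kst 3 t))).*2 <= C1 * q ^ 4.
Proof.
move=> t_gt0; have [C1 [D0 [D0_gt0 HS]]] := degree_sum_bound t_gt0.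
exists C1, D0; split=> // n q le_q le_n; rewrite /turan.
have : (0 : nat).*2 <= C1 * q ^ 4 by [].
elim/big_ind: _ => [//|a b Ha Hb _|G freeG _].
  by rewrite /maxn; case: ifP => _; [apply: Hb | apply: Ha].
by rewrite -handshake; apply: HS; rewrite ?card_ord.
Qed.

Import GRing.Theory.
Local Open Scope ring_scope.

(** * Eliminating one variable from a quadratic and a cubic *)

Lemma prod_XsubC_dvdp (F : fieldType) (s : seq F) (q : {poly F}) : q != 0 ->
  (forall x, count_mem x s <= mup x q)%N -> \prod_(x <- s) ('X - x%:P) %| q.
Proof.
elim: s q => [|x s IHs] q q_neq0 le_s; first by rewrite big_nil dvd1p.
have /dvdpP[q' def_q] : 'X - x%:P %| q.
  by rewrite XsubC_dvd //; have := le_s x; rewrite /= eqxx; apply: leq_trans.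
have [nz_q' nz_x] : q' != 0 /\ 'X - x%:P != 0.
  by apply/andP; rewrite -negb_or -mulf_eq0 -def_q.
rewrite big_cons def_q mulrC dvdp_mul2r //; apply: IHs => // y.
have := le_s y; rewrite def_q mupM //.
have -> : mup y ('X - x%:P) = (x == y) :> nat.
  by have := mup_XsubCX 1 y x; rewrite expr1 => ->; case: eqP.
by rewrite /= addnC leq_add2r.
Qed.

(** Bounds a set of points of the plane by the degree of a polynomial in the
    first coordinate, when its roots account for all points with the same
    first coordinate by multiplicity. *)
Lemma fiber_count (F : fieldType) (s : seq (F * F)) (q : {poly F}) :
  uniq s -> q != 0 ->
  (forall b (l : seq F), uniq l -> (forall u, u \in l -> (b, u) \in s) ->
     (size l <= mup b q)%N) ->
  (size s < size q)%N.
Proof.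
move=> uniq_s nzq fib.
have : \prod_(x <- unzip1 s) ('X - x%:P) %| q.
  apply: prod_XsubC_dvdp => // b.
  rewrite count_map -size_filter -(size_map snd); apply: fib.
    rewrite map_inj_in_uniq ?filter_uniq // => -[x1 x2] [z1 z2].
    by rewrite !mem_filter /= => /andP[/eqP-> _] /andP[/eqP-> _] ->.
  by move=> u /mapP[[b' u']]; rewrite mem_filter /= => /andP[/eqP-> ?] ->.
by move/dvdp_leq => /(_ nzq); rewrite size_prod_XsubC size_map.
Qed.

Definition horner_ringE := (hornerD, hornerN, hornerM, horner_exp, hornerC, hornerX).

(** A quadratic and a cubic in u with coefficients in F[b]. Modulo the
    quadratic, A2^2 times the cubic is K u + M, and R is the resultant of the
    quadratic and K u + M. *)
Section Eliminant.
Variables (F : fieldType) (A2 A1 A0 p3 p2 p1 p0 : {poly F}).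

Definition elimK := A2 ^+ 2 * p1 - A2 * A0 * p3 - (A2 * p2 - A1 * p3) * A1.
Definition elimM := A2 ^+ 2 * p0 - (A2 * p2 - A1 * p3) * A0.
Definition elimR := A2 * elimM ^+ 2 - A1 * elimM * elimK + A0 * elimK ^+ 2.

Definition on_quadratic (b u : F) := A2.[b] * u ^+ 2 + A1.[b] * u + A0.[b] = 0.
Definition on_cubic (b u : F) :=
  p3.[b] * u ^+ 3 + p2.[b] * u ^+ 2 + p1.[b] * u + p0.[b] = 0.

Lemma elim_linear b u : on_quadratic b u -> on_cubic b u ->
  elimK.[b] * u + elimM.[b] = 0.
Proof.
rewrite /on_quadratic /on_cubic => Q0 P0; rewrite /elimK /elimM !horner_ringE.
transitivity (A2.[b] ^+ 2 * (p3.[b] * u ^+ 3 + p2.[b] * u ^+ 2 + p1.[b] * u + p0.[b])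
  - (A2.[b] * p3.[b] * u + A2.[b] * p2.[b] - A1.[b] * p3.[b]) *
    (A2.[b] * u ^+ 2 + A1.[b] * u + A0.[b])); first by ring.
by rewrite P0 Q0 !mulr0 subr0.
Qed.

Lemma linear_two_roots (k m u v : F) : u != v ->
  k * u + m = 0 -> k * v + m = 0 -> k = 0 /\ m = 0.
Proof.
move=> nuv ku kv; have k0 : k = 0.
  have : k * (u - v) = 0.
    transitivity ((k * u + m) - (k * v + m)); first by ring.
    by rewrite ku kv subr0.
  by move/eqP; rewrite mulf_eq0 subr_eq0 (negPf nuv) orbF => /eqP.
by move: ku; rewrite k0 mul0r add0r.
Qed.

Lemma quadratic_three_roots (x2 x1 x0 u v w : F) : u != v -> u != w -> v != w ->
  x2 * u ^+ 2 + x1 * u + x0 = 0 -> x2 * v ^+ 2 + x1 * v + x0 = 0 ->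
  x2 * w ^+ 2 + x1 * w + x0 = 0 -> [/\ x2 = 0, x1 = 0 & x0 = 0].
Proof.
move=> nuv nuw nvw Eu Ev Ew.
have quot t : u != t -> x2 * t ^+ 2 + x1 * t + x0 = 0 -> x2 * t + (x2 * u + x1) = 0.
  move=> nut Et; have : (x2 * t + (x2 * u + x1)) * (u - t) = 0.
    transitivity ((x2 * u ^+ 2 + x1 * u + x0) - (x2 * t ^+ 2 + x1 * t + x0)).
      by ring.
    by rewrite Eu Et subr0.
  by move/eqP; rewrite mulf_eq0 subr_eq0 (negPf nut) orbF => /eqP.
have [x2_0 ] := linear_two_roots nvw (quot v nuv Ev) (quot w nuw Ew).
rewrite x2_0 mul0r add0r => x1_0.
by split=> //; move: Eu; rewrite x2_0 x1_0 !mul0r !add0r.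
Qed.

Lemma root_factor (q : {poly F}) b : q.[b] = 0 -> exists q', q = q' * ('X - b%:P).
Proof.
move=> /eqP qb; exists (q %/ ('X - b%:P)).
by apply/esym/divpK; rewrite dvdp_XsubCl.
Qed.

(** Two common roots u over the same b force K and M to vanish at b, and R is
    a quadratic form in K and M. Three common roots force the quadratic itself
    to vanish at b, and K and M are quadratic in its coefficients. *)
Lemma elim_multiplicity b (s : seq F) : uniq s -> p2.[b] != 0 -> elimR != 0 ->
  (forall u, u \in s -> on_quadratic b u /\ on_cubic b u) ->
  (size s <= mup b elimR)%N.
Proof.
move=> uniq_s nz_p2 nzR sols; rewrite mup_geq //.
have size_s : (size s <= 3)%N.
  pose c := Poly [:: p0.[b]; p1.[b]; p2.[b]; p3.[b]].
  have nzc : c != 0.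
    apply: contraNneq nz_p2 => c0.
    by have := coef_Poly [:: p0.[b]; p1.[b]; p2.[b]; p3.[b]] 2; rewrite -/c c0 coef0 => /= <-.
  have size_c : (size c <= 4)%N by apply: size_Poly.
  apply: leq_trans (_ : (size c).-1 <= 3)%N; last by rewrite -subn1 leq_subLR.
  rewrite -ltnS prednK ?size_poly_gt0 //; apply: max_poly_roots => //.
  apply/allP => u /sols[_]; rewrite /on_cubic /root /c horner_Poly /= => cu.
  by apply/eqP; rewrite -[RHS]cu; ring.
case: s uniq_s sols size_s => [|u [|v [|w [|? ?]]]] //= uniq_s sols _.
- by rewrite expr0 dvd1p.
- have [Qu Pu] := sols u (mem_head _ _).
  rewrite expr1 dvdp_XsubCl /root.
  have Lu : elimM.[b] = - (elimK.[b] * u).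
    by apply/eqP; rewrite -addr_eq0 addrC; apply/eqP/elim_linear.
  rewrite /elimR; move: elimK elimM Lu => K M Lu.
  rewrite !horner_ringE Lu [X in X == _](_ : _ = K.[b] ^+ 2 *
    (A2.[b] * u ^+ 2 + A1.[b] * u + A0.[b])); last by ring.
  by rewrite Qu mulr0.
- have [[Qu Pu] [Qv Pv]] : (on_quadratic b u /\ on_cubic b u) /\
      (on_quadratic b v /\ on_cubic b v).
    by split; apply: sols; rewrite !inE eqxx ?orbT.
  have nuv : u != v by move: uniq_s; rewrite inE andbT.
  have [K0 M0] := linear_two_roots nuv (elim_linear Qu Pu) (elim_linear Qv Pv).
  have [[K' defK] [M' defM]] := (root_factor K0, root_factor M0).
  rewrite /elimR defK defM.
  apply/dvdpP; exists (A2 * M' ^+ 2 - A1 * M' * K' + A0 * K' ^+ 2).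
  by ring.
- have /and3P[nu nv _] := uniq_s; move: nu nv; rewrite !inE negb_or.
  move=> /andP[nuv nuw] nvw.
  have [[Qu _] [Qv _] [Qw _]] : [/\ on_quadratic b u /\ on_cubic b u,
      on_quadratic b v /\ on_cubic b v & on_quadratic b w /\ on_cubic b w].
    by split; apply: sols; rewrite !inE eqxx ?orbT.
  have [z2 z1 z0] := quadratic_three_roots nuv nuw nvw Qu Qv Qw.
  have [[B2 E2] [B1 E1] [B0 E0]] := And3 (root_factor z2) (root_factor z1) (root_factor z0).
  apply/dvdpP; rewrite /elimR /elimM /elimK E2 E1 E0; eexists.
  set x := 'X - _.
  pose K' := B2 ^+ 2 * p1 - B2 * B0 * p3 - (B2 * p2 - B1 * p3) * B1.
  pose M' := B2 ^+ 2 * p0 - (B2 * p2 - B1 * p3) * B0.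
  rewrite [RHS](_ : _ = (x ^+ 2 * (B2 * M' ^+ 2 - B1 * M' * K' + B0 * K' ^+ 2)) * x ^+ 3) //.
  by rewrite /K' /M'; ring.
Qed.

Lemma elim_count (s : seq (F * F)) : uniq s -> elimR != 0 ->
  (forall y, y \in s ->
     [/\ p2.[y.1] != 0, on_quadratic y.1 y.2 & on_cubic y.1 y.2]) ->
  (size s < size elimR)%N.
Proof.
move=> uniq_s nzR sols; apply: fiber_count => // b l uniq_l inl.
case: l uniq_l inl => [|u l] // uniq_l inl.
apply: elim_multiplicity => //; last by move=> v /inl/sols[].
by have [] := sols _ (inl u (mem_head _ _)).
Qed.

(** If R = 0 then - M / K, in lowest terms N / D, is a common root over the
    field of rational functions. *)
Lemma elim_rational_root : A2 != 0 -> elimR = 0 -> (elimK != 0) || (elimM != 0) ->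
  exists N D : {poly F}, [/\ D != 0, coprimep D N,
    A2 * N ^+ 2 + A1 * N * D + A0 * D ^+ 2 = 0 &
    p3 * N ^+ 3 + p2 * N ^+ 2 * D + p1 * N * D ^+ 2 + p0 * D ^+ 3 = 0].
Proof.
move=> nzA R0 nzKM.
have nzK : elimK != 0.
  apply: contraTneq nzKM => K0; rewrite K0 eqxx /=.
  move: R0; rewrite /elimR K0 expr0n /= !mulr0 subr0 addr0 => /eqP.
  by rewrite mulf_eq0 (negPf nzA) expf_eq0 /= => ->.
pose g := gcdp elimK elimM.
have nzg : g != 0 by rewrite gcdp_eq0 (negPf nzK).
pose D := elimK %/ g; pose N := - (elimM %/ g).
have defK : elimK = D * g by rewrite divpK ?dvdp_gcdl.
have defM : elimM = - N * g by rewrite opprK divpK ?dvdp_gcdr.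
have nzD : D != 0 by apply: contraNneq nzK => D0; rewrite defK D0 mul0r.
have Q0 : A2 * N ^+ 2 + A1 * N * D + A0 * D ^+ 2 = 0.
  have /eqP : (A2 * N ^+ 2 + A1 * N * D + A0 * D ^+ 2) * g ^+ 2 = 0.
    by rewrite -R0 /elimR defK defM; ring.
  by rewrite mulf_eq0 expf_eq0 (negPf nzg) orbF => /eqP.
exists N, D; split=> //.
  rewrite coprimep_sym /N -scaleN1r coprimepZl ?oppr_eq0 ?oner_eq0 //.
  by rewrite coprimep_sym coprimep_div_gcd ?nzK.
have /eqP : (A2 ^+ 2 * (p3 * N ^+ 3 + p2 * N ^+ 2 * D + p1 * N * D ^+ 2 + p0 * D ^+ 3)) * g = 0.
  transitivity ((A2 * p3 * N + (A2 * p2 - A1 * p3) * D) *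
      (A2 * N ^+ 2 + A1 * N * D + A0 * D ^+ 2) * g +
      (elimK * N + elimM * D) * D ^+ 2 * g); first by rewrite /elimK /elimM; ring.
  by rewrite Q0 defK defM; ring.
by rewrite !mulf_eq0 (negPf nzg) (negPf nzA) orbF /= => /eqP.
Qed.

End Eliminant.

(** * Degrees and leading coefficients of products *)

Section Degree.
Variable R : idomainType.
Implicit Types p q : {poly R}.

Lemma leq_sizeD n p q : (size p <= n -> size q <= n -> size (p + q)%R <= n)%N.
Proof. by move=> sp sq; rewrite (leq_trans (size_polyD _ _)) // geq_max sp. Qed.

Lemma leq_sizeB n p q : (size p <= n -> size q <= n -> size (p - q)%R <= n)%N.
Proof. by move=> sp sq; rewrite leq_sizeD ?size_polyN. Qed.

Lemma leq_sizeM m n p q :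
  (size p <= m.+1 -> size q <= n.+1 -> size (p * q)%R <= (m + n).+1)%N.
Proof.
move=> sp sq; apply: leq_trans (size_polyMleq _ _) _.
by rewrite -subn1 leq_subLR add1n -addnS -addSn leq_add.
Qed.

Lemma leq_sizeX m n p : (size p <= m.+1 -> size (p ^+ n)%R <= (m * n).+1)%N.
Proof.
move=> sp; elim: n => [|n IHn]; first by rewrite expr0 muln0 size_poly1.
by rewrite exprS mulnS leq_sizeM.
Qed.

Lemma coef_top_mul m n p q : (size p <= m.+1)%N -> (size q <= n.+1)%N ->
  (p * q)`_(m + n) = p`_m * q`_n.
Proof.
move=> sp sq; rewrite coefM (bigD1 (Ordinal (leq_addr n m : (m < (m + n).+1)%N))) //=.
rewrite addKn big1 ?addr0 // => i; rewrite -val_eqE /= => ni.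
have [lt_im|] := ltnP i m; last first.
  rewrite leq_eqVlt eq_sym (negPf ni) /= => lt_mi.
  by rewrite (nth_default _ (leq_trans sp lt_mi)) mul0r.
rewrite [q`__]nth_default ?mulr0 // (leq_trans sq) // ltn_subRL.
by rewrite ltn_add2r.
Qed.

Lemma coef_top_exp m n p : (size p <= m.+1)%N -> (p ^+ n)`_(m * n) = p`_m ^+ n.
Proof.
move=> sp; elim: n => [|n IHn]; first by rewrite muln0 !expr0 coef1.
by rewrite !exprS mulnS coef_top_mul ?IHn // leq_sizeX.
Qed.

End Degree.

(** * Three surfaces over distinct first coordinates *)

Lemma char3_mul3n (R : comNzRingType) (n : nat) : 3%:R = 0 :> R -> (3 * n)%:R = 0 :> R.
Proof. by move=> h; rewrite natrM h mul0r. Qed.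

Lemma char3_oppr_mul3n (R : comNzRingType) (n : nat) :
  3%:R = 0 :> R -> - (3 * n)%:R = 0 :> R.
Proof. by move/char3_mul3n->; rewrite oppr0. Qed.

Lemma char3_poly (F : fieldType) : 3%:R = 0 :> F -> 3%:R = 0 :> {poly F}.
Proof. by move=> h; rewrite -(rmorph_nat (@polyC F)) h. Qed.

(** Proves ring identities from [h : 3%:R = 0]. The ring tactic discards a term
    only if its coefficient is exactly that of a given equation, so it is handed
    the equations for the small multiples of 3 of both signs. *)
Ltac char3_ring h :=
  apply/eqP; rewrite -subr_eq0; apply/eqP;
  ring: (char3_mul3n 1 h) (char3_oppr_mul3n 1 h) (char3_mul3n 2 h) (char3_oppr_mul3n 2 h)
    (char3_mul3n 3 h) (char3_oppr_mul3n 3 h) (char3_mul3n 4 h) (char3_oppr_mul3n 4 h)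
    (char3_mul3n 5 h) (char3_oppr_mul3n 5 h) (char3_mul3n 6 h) (char3_oppr_mul3n 6 h)
    (char3_mul3n 7 h) (char3_oppr_mul3n 7 h) (char3_mul3n 8 h) (char3_oppr_mul3n 8 h)
    (char3_mul3n 9 h) (char3_oppr_mul3n 9 h) (char3_mul3n 10 h) (char3_oppr_mul3n 10 h).

Section Surface.
Variable F : fieldType.
Hypothesis char3 : 3%:R = 0 :> F.

Let char3P := char3_poly char3.

Implicit Types (a b u v : F) (f g U N D : {poly F}).

(** The surface of a root with first coordinate a consists of the (b, u, v)
    with (b - a)^2 v = (b + a) u^3 + (b - a)^3 u^2 + (b - a)^2 f(b) u + g(b),
    where only f and g depend on the other coordinates of the root.
    Eliminating v between the surfaces of a and a' gives the cubic in u with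
    the coefficients [cf3], [cf2], [cf1] and [cf0]. The combination of three
    surfaces with the weights [wpol] contains neither v nor u^3; its
    coefficients are [qf2], [qf1] and [qf0]. *)
Definition dpol a : {poly F} := 'X - a%:P.
Definition spol a : {poly F} := 'X + a%:P.

Definition cf3 a a' := dpol a' ^+ 2 * spol a - dpol a ^+ 2 * spol a'.
Definition cf2 a a' := dpol a' ^+ 2 * dpol a ^+ 3 - dpol a ^+ 2 * dpol a' ^+ 3.
Definition cf1 a f a' f' := dpol a ^+ 2 * dpol a' ^+ 2 * (f - f').
Definition cf0 a g a' g' := dpol a' ^+ 2 * g - dpol a ^+ 2 * g'.

Definition wpol a a' := (a - a')%:P * ((a + a')%:P * 'X + (a * a')%:P).

Definition qf2 a1 a2 a3 := wpol a2 a3 * dpol a1 ^+ 3 + wpol a3 a1 * dpol a2 ^+ 3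
  + wpol a1 a2 * dpol a3 ^+ 3.
Definition qf1 a1 f1 a2 f2 a3 f3 := wpol a2 a3 * dpol a1 ^+ 2 * f1
  + wpol a3 a1 * dpol a2 ^+ 2 * f2 + wpol a1 a2 * dpol a3 ^+ 2 * f3.
Definition qf0 a1 g1 a2 g2 a3 g3 :=
  wpol a2 a3 * g1 + wpol a3 a1 * g2 + wpol a1 a2 * g3.

Definition vdm a1 a2 a3 := (a1 - a2) * (a2 - a3) * (a1 - a3).

(** In characteristic 3 the terms of degree 2 in b cancel. *)
Lemma cf3E a a' : cf3 a a' = - wpol a a'.
Proof. by rewrite /cf3 /wpol /dpol /spol; char3_ring char3P. Qed.

Lemma cf2E a a' : cf2 a a' = dpol a ^+ 2 * dpol a' ^+ 2 * (a' - a)%:P.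
Proof. by rewrite /cf2 /dpol; ring. Qed.

Lemma qf2E a1 a2 a3 : qf2 a1 a2 a3 = (vdm a1 a2 a3)%:P *
  ('X ^+ 3 - (a1 * a2 + a2 * a3 + a3 * a1)%:P * 'X - (a1 * a2 * a3)%:P).
Proof. by rewrite /qf2 /vdm /wpol /dpol; char3_ring char3P. Qed.

(** The quadratic is a combination of two of the cubics, in homogeneous form.
    So a common root of the quadratic and the first cubic is a root of the
    second one. *)
Lemma quadratic_cubics a1 f1 g1 a2 f2 g2 a3 f3 g3 N D :
  dpol a1 ^+ 2 * (qf2 a1 a2 a3 * N ^+ 2 + qf1 a1 f1 a2 f2 a3 f3 * N * D
                   + qf0 a1 g1 a2 g2 a3 g3 * D ^+ 2) * D =
  - wpol a3 a1 * (cf3 a1 a2 * N ^+ 3 + cf2 a1 a2 * N ^+ 2 * D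
                  + cf1 a1 f1 a2 f2 * N * D ^+ 2 + cf0 a1 g1 a2 g2 * D ^+ 3)
  - wpol a1 a2 * (cf3 a1 a3 * N ^+ 3 + cf2 a1 a3 * N ^+ 2 * D
                  + cf1 a1 f1 a3 f3 * N * D ^+ 2 + cf0 a1 g1 a3 g3 * D ^+ 3).
Proof.
rewrite /qf2 /qf1 /qf0 /cf3 /cf2 /cf1 /cf0 /wpol /dpol /spol.
by char3_ring char3P.
Qed.

Lemma vdm_neq0 a1 a2 a3 : a1 != a2 -> a2 != a3 -> a1 != a3 -> vdm a1 a2 a3 != 0.
Proof. by move=> n12 n23 n13; rewrite /vdm !mulf_neq0 // subr_eq0. Qed.

Lemma size_qf2 a1 a2 a3 : vdm a1 a2 a3 != 0 -> size (qf2 a1 a2 a3) = 4.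
Proof.
move=> nzV; rewrite qf2E size_Cmul // -addrA.
rewrite size_polyDl size_polyXn // ltnS -opprD size_polyN.
apply: leq_trans (size_polyD _ _) _; rewrite geq_max (leq_trans (size_polyC_leq1 _)) //.
by rewrite andbT mul_polyC (leq_trans (size_scale_leq _ _)) // size_polyX.
Qed.

Lemma wpol_neq0 a a' : a != a' -> a != 0 -> wpol a a' != 0.
Proof.
move=> naa' nza; rewrite mulf_neq0 ?polyC_eq0 ?subr_eq0 //.
apply: contraTneq naa' => /polyP E; have := E 1%N; have := E 0%N.
rewrite !coefD !coefCM !coefX !coefC /= mulr0 mulr1 add0r addr0.
move=> /eqP; rewrite mulf_eq0 (negPf nza) /= => /eqP -> /eqP.
by rewrite addr0 (negPf nza).
Qed.

Section Roots.
Variables (a1 a2 a3 : F) (f1 f2 f3 g1 g2 g3 : {poly F}).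
Hypotheses (n12 : a1 != a2) (n23 : a2 != a3) (n13 : a1 != a3) (nz1 : a1 != 0).

Notation A2 := (qf2 a1 a2 a3).
Notation A1 := (qf1 a1 f1 a2 f2 a3 f3).
Notation A0 := (qf0 a1 g1 a2 g2 a3 g3).
Notation K := (elimK A2 A1 A0 (cf3 a1 a2) (cf2 a1 a2) (cf1 a1 f1 a2 f2)).
Notation M := (elimM A2 A1 A0 (cf3 a1 a2) (cf2 a1 a2) (cf0 a1 g1 a2 g2)).
Notation R := (elimR A2 A1 A0 (cf3 a1 a2) (cf2 a1 a2) (cf1 a1 f1 a2 f2)
   (cf0 a1 g1 a2 g2)).

(** The denominator D of a common rational root divides the leading
    coefficients of two of the cubics. These are coprime polynomials of degree
    at most 1, so the root is a polynomial U. As the quadratic has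
    coefficients of degrees 3, at most 4 and at most 4, its root U has degree
    at most 1. *)
Lemma common_curve : (size A1 <= 5)%N -> (size A0 <= 5)%N ->
  (K != 0) || (M != 0) -> R = 0 ->
  exists2 U : {poly F}, (size U <= 2)%N &
    cf3 a1 a2 * U ^+ 3 + cf2 a1 a2 * U ^+ 2 + cf1 a1 f1 a2 f2 * U
       + cf0 a1 g1 a2 g2 = 0 /\
    cf3 a1 a3 * U ^+ 3 + cf2 a1 a3 * U ^+ 2 + cf1 a1 f1 a3 f3 * U
       + cf0 a1 g1 a3 g3 = 0.
Proof.
move=> sA1 sA0 nzKM R0; have nzV := vdm_neq0 n12 n23 n13.
have nzA2 : A2 != 0 by rewrite -size_poly_eq0 size_qf2.
have [N [D [nzD coDN Q0 P12]]] := elim_rational_root nzA2 R0 nzKM.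
have P13 : cf3 a1 a3 * N ^+ 3 + cf2 a1 a3 * N ^+ 2 * D
   + cf1 a1 f1 a3 f3 * N * D ^+ 2 + cf0 a1 g1 a3 g3 * D ^+ 3 = 0.
  have := quadratic_cubics a1 f1 g1 a2 f2 g2 a3 f3 g3 N D.
  rewrite Q0 P12 !(mulr0, mul0r) sub0r => /eqP; rewrite eq_sym oppr_eq0 mulf_eq0.
  by rewrite (negPf (wpol_neq0 n12 nz1)) => /eqP.
have div_lead (c3 c2 c1 c0 : {poly F}) :
    c3 * N ^+ 3 + c2 * N ^+ 2 * D + c1 * N * D ^+ 2 + c0 * D ^+ 3 = 0 -> D %| c3.
  move=> E; rewrite -(Gauss_dvdpl c3 (coprimep_expr 3 coDN)).
  apply/dvdpP; exists (- (c2 * N ^+ 2 + c1 * N * D + c0 * D ^+ 2)).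
  by apply/eqP; rewrite -subr_eq0; apply/eqP; rewrite -[RHS]E; ring.
have D3 : D %| wpol a1 a2 by have := div_lead _ _ _ _ P12; rewrite cf3E dvdpNr.
have D2 : D %| wpol a1 a3 by have := div_lead _ _ _ _ P13; rewrite cf3E dvdpNr.
have sD : size D = 1%N.
  (* Up to sign, the resultant of the two leading coefficients. *)
  pose c := (a1 - a3) * (a1 - a2) * (a1 ^+ 2 * (a2 - a3)).
  have nzc : c != 0 by rewrite !mulf_neq0 ?expf_neq0 ?subr_eq0.
  have : D %| c%:P.
    have -> : c%:P = ((a1 - a3) * (a1 + a3))%:P * wpol a1 a2
                   - ((a1 - a2) * (a1 + a2))%:P * wpol a1 a3.
      by rewrite /c /wpol; ring.
    by apply: dvdp_sub; apply: dvdp_mull.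
  move/dvdp_leq; rewrite polyC_eq0 nzc size_polyC nzc => /(_ isT) sD.
  by apply/eqP; rewrite eqn_leq sD size_poly_gt0.
have /size_poly1P[c nzc defD] : size D == 1%N by rewrite sD.
pose U : {poly F} := c^-1 *: N.
have defN : N = U * D by rewrite defD mulrC mul_polyC scalerA divff ?scale1r.
have cancelD n (q : {poly F}) : q * D ^+ n = 0 -> q = 0.
  by move/eqP; rewrite mulf_eq0 expf_eq0 (negPf nzD) andbF orbF => /eqP.
have Q0U : A2 * U ^+ 2 + A1 * U + A0 = 0.
  by apply: (cancelD 2); rewrite -[RHS]Q0 defN; ring.
exists U; last first.
  split; first by apply: (cancelD 3); rewrite -[RHS]P12 defN; ring.
  by apply: (cancelD 3); rewrite -[RHS]P13 defN; ring.
rewrite leqNgt; apply/negP => sU.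
have nzU : U != 0 by rewrite -size_poly_gt0 (ltn_trans _ sU).
have : (size (A2 * U ^+ 2)%R <= size U + 4)%N.
  have -> : A2 * U ^+ 2 = - (A1 * U + A0).
    by apply/eqP; rewrite -addr_eq0 addrA Q0U.
  rewrite size_polyN (leq_trans (size_polyD _ _)) // geq_max.
  apply/andP; split; last first.
    apply: (leq_trans sA0); rewrite -[5%N]/(1 + 4)%N leq_add2r.
    by apply: ltnW; apply: ltnW.
  apply: leq_trans (size_polyMleq _ _) _.
  apply: leq_trans (_ : (5 + size U).-1 <= _)%N; last by rewrite [leqRHS]addnC.
  by rewrite -!subn1 leq_sub2r // leq_add2r.
rewrite size_mul ?expf_neq0 // size_qf2 // expr2 size_mul //=.
by move: (size U) sU => k; clear; lia.
Qed.

End Roots.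
End Surface.

Section Count.
Variable F : fieldType.
Hypothesis char3 : 3%:R = 0 :> F.

Let char3P := char3_poly char3.

Implicit Types (a b u v : F) (f g U N D : {poly F}).

Lemma size_dpol a : (size (dpol a) <= 2)%N.
Proof. by rewrite size_XsubC. Qed.

Lemma size_spol a : (size (spol a) <= 2)%N.
Proof. by rewrite /spol -[a]opprK polyCN size_XsubC. Qed.

Lemma size_lin a b : (size (a%:P * 'X + b%:P)%R <= 2)%N.
Proof.
apply: leq_sizeD; last by rewrite (leq_trans (size_polyC_leq1 _)).
by apply: (@leq_sizeM _ 0 1); rewrite ?size_polyX ?size_polyC_leq1.
Qed.

Lemma size_wpol a a' : (size (wpol a a') <= 2)%N.
Proof. by apply: (@leq_sizeM _ 0 1); rewrite ?size_lin ?size_polyC_leq1. Qed.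

Lemma size_cf3 a a' : (size (cf3 a a') <= 2)%N.
Proof. by rewrite cf3E // size_polyN size_wpol. Qed.

Lemma size_dpolX a n : (size (dpol a ^+ n)%R <= n.+1)%N.
Proof. by rewrite -[n in n.+1]mul1n leq_sizeX ?size_dpol. Qed.

Lemma size_cf2 a a' : (size (cf2 a a') <= 5)%N.
Proof.
rewrite cf2E; apply: (@leq_sizeM _ 4 0); rewrite ?size_polyC_leq1 //.
by apply: (@leq_sizeM _ 2 2); rewrite size_dpolX.
Qed.

Lemma size_cf1 a f a' f' : (size (f - f')%R <= 2)%N -> (size (cf1 a f a' f') <= 6)%N.
Proof.
move=> sf; apply: (@leq_sizeM _ 4 1) => //.
by apply: (@leq_sizeM _ 2 2); rewrite size_dpolX.
Qed.

Lemma horner_dpol a b : (dpol a).[b] = b - a.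
Proof. by rewrite /dpol !horner_ringE. Qed.

Lemma cf2_neq0 a a' b : a != a' -> b != a -> b != a' -> (cf2 a a').[b] != 0.
Proof.
move=> naa' nba nba'; rewrite cf2E !(horner_exp, hornerM, horner_dpol, hornerC).
by rewrite !mulf_neq0 ?expf_neq0 // subr_eq0 // eq_sym.
Qed.

Lemma coef_dpolX a n : (dpol a ^+ n)`_n = 1.
Proof.
rewrite -[n in _`_n]mul1n coef_top_exp ?size_dpol //.
by rewrite /dpol coefB coefX coefC subr0 expr1n.
Qed.

Lemma coef_wpol a a' : (wpol a a')`_1 = (a - a') * (a + a').
Proof. by rewrite /wpol coefCM coefD coefCM coefX coefC addr0 mulr1. Qed.

Lemma coef_qf2 a1 a2 a3 : (qf2 a1 a2 a3)`_3 = vdm a1 a2 a3.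
Proof.
by rewrite qf2E // coefCM !coefB coefXn coefCM coefX coefC mulr0 !subr0 mulr1.
Qed.

Lemma coef_cf2 a a' : (cf2 a a')`_4 = a' - a.
Proof.
rewrite cf2E (@coef_top_mul _ 4 0) ?size_polyC_leq1 //; last first.
  by apply: (@leq_sizeM _ 2 2); rewrite size_dpolX.
by rewrite (@coef_top_mul _ 2 2) ?size_dpolX // !coef_dpolX !mul1r coefC.
Qed.

Lemma coef_cf1 a f a' f' : (size (f - f')%R <= 2)%N ->
  (cf1 a f a' f')`_5 = (f - f')`_1.
Proof.
move=> sf; rewrite (@coef_top_mul _ 4 1) //; last first.
  by apply: (@leq_sizeM _ 2 2); rewrite size_dpolX.
by rewrite (@coef_top_mul _ 2 2) ?size_dpolX // !coef_dpolX !mul1r.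
Qed.

Section Triple.
Variables (a1 a2 a3 : F) (f1 f2 f3 g1 g2 g3 : {poly F}).
Hypotheses (n12 : a1 != a2) (n23 : a2 != a3) (n13 : a1 != a3).
Hypotheses (nz1 : a1 != 0) (nz2 : a2 != 0) (nz3 : a3 != 0).

Notation A2 := (qf2 a1 a2 a3).
Notation A1 := (qf1 a1 f1 a2 f2 a3 f3).
Notation A0 := (qf0 a1 g1 a2 g2 a3 g3).
Notation K := (elimK A2 A1 A0 (cf3 a1 a2) (cf2 a1 a2) (cf1 a1 f1 a2 f2)).
Notation M := (elimM A2 A1 A0 (cf3 a1 a2) (cf2 a1 a2) (cf0 a1 g1 a2 g2)).
Notation R := (elimR A2 A1 A0 (cf3 a1 a2) (cf2 a1 a2) (cf1 a1 f1 a2 f2)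
   (cf0 a1 g1 a2 g2)).

Definition on_surface a f g b u w :=
  (b - a) ^+ 2 * w = (b + a) * u ^+ 3 + (b - a) ^+ 3 * u ^+ 2
                     + (b - a) ^+ 2 * f.[b] * u + g.[b].

(** The second coordinate of the point is u; the value w of v is common to the
    three surfaces. *)
Definition on_three (y : F * F) := exists2 w : F,
  [/\ y.1 != a1, y.1 != a2 & y.1 != a3] &
  [/\ on_surface a1 f1 g1 y.1 y.2 w, on_surface a2 f2 g2 y.1 y.2 w &
      on_surface a3 f3 g3 y.1 y.2 w].

Lemma on_three_eqs y : on_three y ->
  [/\ (cf2 a1 a2).[y.1] != 0, on_quadratic A2 A1 A0 y.1 y.2 &
   on_cubic (cf3 a1 a2) (cf2 a1 a2) (cf1 a1 f1 a2 f2) (cf0 a1 g1 a2 g2) y.1 y.2].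
Proof.
case: y => b u [w /= [nb1 nb2 nb3] [E1 E2 E3]]; split; first exact: cf2_neq0.
  rewrite /on_quadratic /qf2 /qf1 /qf0.
  rewrite /wpol /dpol !horner_ringE.
  transitivity (((a2 - a3) * ((a2 + a3) * b + a2 * a3)) * ((b - a1) ^+ 2 * w)
    + ((a3 - a1) * ((a3 + a1) * b + a3 * a1)) * ((b - a2) ^+ 2 * w)
    + ((a1 - a2) * ((a1 + a2) * b + a1 * a2)) * ((b - a3) ^+ 2 * w)).
    by rewrite E1 E2 E3; char3_ring char3.
  by char3_ring char3.
rewrite /on_cubic /cf3 /cf2 /cf1 /cf0.
rewrite /dpol /spol !horner_ringE.
transitivity ((b - a2) ^+ 2 * ((b - a1) ^+ 2 * w)
  - (b - a1) ^+ 2 * ((b - a2) ^+ 2 * w)); last by ring.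
by rewrite E1 E2; ring.
Qed.

Hypotheses (sf : (size (f1 - f2)%R <= 2)%N) (sA1 : (size A1 <= 5)%N)
  (sA0 : (size A0 <= 5)%N) (sp0 : (size (cf0 a1 g1 a2 g2) <= 6)%N).

Lemma size_eliminant : (size R <= 27)%N.
Proof.
have sA2 : (size A2 <= 4)%N by rewrite size_qf2 // vdm_neq0.
have sp3 := size_cf3 a1 a2; have sp2 := size_cf2 a1 a2.
have sp1 := @size_cf1 a1 f1 a2 f2 sf.
have sL : (size (A2 * cf2 a1 a2 - A1 * cf3 a1 a2)%R <= 8)%N.
  apply: leq_sizeB; first exact: (@leq_sizeM _ 3 4).
  by apply: leq_trans (@leq_sizeM _ 4 1 _ _ _ _) _.
have sA22 : (size (A2 ^+ 2)%R <= 7)%N by apply: (@leq_sizeX _ 3 2).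
have sK : (size K <= 12)%N.
  apply: leq_sizeB; last exact: (@leq_sizeM _ 7 4).
  apply: leq_sizeB; first exact: (@leq_sizeM _ 6 5).
  apply: leq_trans (@leq_sizeM _ 7 1 _ _ _ _) _ => //.
  exact: (@leq_sizeM _ 3 4).
have sM : (size M <= 12)%N.
  by apply: leq_sizeB; [apply: (@leq_sizeM _ 6 5)|apply: (@leq_sizeM _ 7 4)].
rewrite /elimR; move: (K) (M) sK sM => k m sk sm.
apply: leq_sizeD.
  apply: leq_sizeB.
    apply: leq_trans (@leq_sizeM _ 3 22 _ _ _ _) _ => //.
    exact: (@leq_sizeX _ 11 2).
  by apply: (@leq_sizeM _ 15 11) => //; apply: (@leq_sizeM _ 4 11).
by apply: (@leq_sizeM _ 4 22) => //; apply: (@leq_sizeX _ 11 2).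
Qed.

(** K has degree at most 11, and this coefficient serves to show that K is not
    0. *)
Lemma coefK : K`_11 = vdm a1 a2 a3 *
  (vdm a1 a2 a3 * (f1 - f2)`_1 + (a1 - a2) * A1`_4).
Proof.
have sA2 : (size A2 <= 4)%N by rewrite size_qf2 // vdm_neq0.
have sp3 := size_cf3 a1 a2; have sp2 := size_cf2 a1 a2.
have sp1 := @size_cf1 a1 f1 a2 f2 sf.
have sA22 : (size (A2 ^+ 2)%R <= 7)%N by apply: (@leq_sizeX _ 3 2).
have -> : K = A2 ^+ 2 * cf1 a1 f1 a2 f2 - A2 * cf2 a1 a2 * A1
  + (A1 * cf3 a1 a2 * A1 - A2 * A0 * cf3 a1 a2) by rewrite /elimK; ring.
rewrite [LHS]coefD [X in X + _ = _]coefB (@coef_top_mul _ 6 5) // (@coef_top_mul _ 7 4) //; last first.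
  exact: (@leq_sizeM _ 3 4).
rewrite (@coef_top_mul _ 3 4) // (@coef_top_exp _ 3 2) // coef_cf1 // coef_cf2 coef_qf2.
rewrite [X in _ + X]nth_default ?addr0; first by ring.
apply: leq_sizeB; apply: (@leq_trans 10) => //.
  by apply: (@leq_sizeM _ 5 4) => //; apply: (@leq_sizeM _ 4 1).
by apply: (@leq_sizeM _ 8 1) => //; apply: leq_trans (@leq_sizeM _ 3 4 _ _ _ _) _.
Qed.

Lemma coefM10 : (size A0 <= 4)%N -> (size (cf0 a1 g1 a2 g2) <= 5)%N ->
  M`_10 = vdm a1 a2 a3 *
  (vdm a1 a2 a3 * (cf0 a1 g1 a2 g2)`_4 + (a1 - a2) * A0`_3).
Proof.
move=> sA0' sp0'.
have sA2 : (size A2 <= 4)%N by rewrite size_qf2 // vdm_neq0.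
have sp3 := size_cf3 a1 a2; have sp2 := size_cf2 a1 a2.
have sA22 : (size (A2 ^+ 2)%R <= 7)%N by apply: (@leq_sizeX _ 3 2).
have -> : M = A2 ^+ 2 * cf0 a1 g1 a2 g2 - A2 * cf2 a1 a2 * A0
  + (A1 * cf3 a1 a2 * A0) by rewrite /elimM; ring.
rewrite [LHS]coefD [X in X + _ = _]coefB (@coef_top_mul _ 6 4) // (@coef_top_mul _ 7 3) //; last first.
  exact: (@leq_sizeM _ 3 4).
rewrite (@coef_top_mul _ 3 4) // (@coef_top_exp _ 3 2) // coef_cf2 coef_qf2.
rewrite [X in _ + X]nth_default ?addr0; first by ring.
apply: (@leq_trans 9) => //.
by apply: (@leq_sizeM _ 5 3) => //; apply: (@leq_sizeM _ 4 1).
Qed.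

(** Either R is not 0 and has degree at most 26, or the surfaces share an
    affine curve U; its value at a_i is then prescribed by g_i, since the
    equations of the cubics degenerate at b = a_i. *)
Lemma triple_count (s : seq (F * F)) : uniq s -> (K != 0) || (M != 0) ->
  (forall U : {poly F}, (size U <= 2)%N ->
     [/\ (a1 *+ 2) * U.[a1] ^+ 3 + g1.[a1] = 0,
         (a2 *+ 2) * U.[a2] ^+ 3 + g2.[a2] = 0 &
         (a3 *+ 2) * U.[a3] ^+ 3 + g3.[a3] = 0] ->
     cf3 a1 a2 * U ^+ 3 + cf2 a1 a2 * U ^+ 2 + cf1 a1 f1 a2 f2 * U
       + cf0 a1 g1 a2 g2 = 0 ->
     cf3 a1 a3 * U ^+ 3 + cf2 a1 a3 * U ^+ 2 + cf1 a1 f1 a3 f3 * U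
       + cf0 a1 g1 a3 g3 = 0 -> False) ->
  (forall y, y \in s -> on_three y) -> (size s <= 26)%N.
Proof.
move=> uniq_s nzKM noU sols; have [R0|nzR] := eqVneq R 0; last first.
  rewrite -ltnS; apply: leq_trans size_eliminant.
  by apply: elim_count uniq_s nzR _ => y /sols/on_three_eqs.
have [U sU [P12 P13]] := common_curve char3 n12 n23 n13 nz1 sA1 sA0 nzKM R0.
have vertex a f g a' f' g' : a != a' ->
    cf3 a a' * U ^+ 3 + cf2 a a' * U ^+ 2 + cf1 a f a' f' * U + cf0 a g a' g' = 0 ->
    (a *+ 2) * U.[a] ^+ 3 + g.[a] = 0 /\ (a' *+ 2) * U.[a'] ^+ 3 + g'.[a'] = 0.
  move=> naa' E; have nz : (a' - a) ^+ 2 != 0 by rewrite expf_neq0 ?subr_eq0 1?eq_sym.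
  split; apply: (mulfI nz).
    rewrite mulr0 -[RHS](horner0 a) -E /cf3 /cf2 /cf1 /cf0.
    rewrite /dpol /spol !horner_ringE.
    by ring.
  apply/eqP; rewrite -eqr_opp mulr0 oppr0 -[X in _ == X](horner0 a') -E /cf3 /cf2 /cf1 /cf0.
  rewrite /dpol /spol !horner_ringE.
  by apply/eqP; ring.
have [V1 V2] := vertex _ _ _ _ _ _ n12 P12.
by have [_ V3] := vertex _ _ _ _ _ _ n13 P13; case: (noU U).
Qed.

End Triple.
End Count.

(** * Roots in general position *)

Section Points.
Variable F : fieldType.
Hypothesis char3 : 3%:R = 0 :> F.

Let char3P := char3_poly char3.

Implicit Types (a b c k p q u v : F).

Lemma cube_inj u v : u ^+ 3 = v ^+ 3 -> u = v.
Proof.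
move=> E; apply/eqP; rewrite -subr_eq0.
suff /eqP : (u - v) ^+ 3 = 0 by rewrite expf_eq0.
by transitivity (u ^+ 3 - v ^+ 3); [char3_ring char3 | rewrite E subrr].
Qed.

Lemma size2_eval (U : {poly F}) b : (size U <= 2)%N -> U.[b] = U`_1 * b + U`_0.
Proof.
move=> sU; rewrite (horner_coef_wide _ sU) big_ord_recl big_ord1 /=.
by rewrite expr0 mulr1 expr1 addrC.
Qed.

Definition three_dir (a1 a2 a3 u1 u2 u3 : F) :=
  (a2 ^+ 2 - a3 ^+ 2) * u1 + (a3 ^+ 2 - a1 ^+ 2) * u2 + (a1 ^+ 2 - a2 ^+ 2) * u3.

(** Up to a nonzero factor this is the coefficient of degree 11 of K. It
    vanishes for both orders of the last two points exactly when the three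
    points are collinear. *)
Definition tilt (a1 a2 a3 u1 u2 u3 : F) :=
  vdm a1 a2 a3 * (u1 - u2) + (a1 - a2) * three_dir a1 a2 a3 u1 u2 u3.

Lemma tilt_affine a1 a2 a3 k c :
  tilt a1 a2 a3 (k * a1 + c) (k * a2 + c) (k * a3 + c) = 0.
Proof. by rewrite /tilt /three_dir /vdm; char3_ring char3. Qed.

Lemma affine_of_tilt a1 a2 a3 u1 u2 u3 : vdm a1 a2 a3 != 0 ->
  tilt a1 a2 a3 u1 u2 u3 = 0 -> tilt a1 a3 a2 u1 u3 u2 = 0 ->
  exists k c, [/\ u1 = k * a1 + c, u2 = k * a2 + c & u3 = k * a3 + c].
Proof.
move=> nzV T2 T3; pose e := three_dir a1 a2 a3 u1 u2 u3.
exists (- (e / vdm a1 a2 a3)), (u1 + e / vdm a1 a2 a3 * a1).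
have Ve : vdm a1 a2 a3 * (e / vdm a1 a2 a3) = e by rewrite mulrC divfK.
split; apply: (mulfI nzV); first by ring.
  transitivity (vdm a1 a2 a3 * u1 - tilt a1 a2 a3 u1 u2 u3 + (a1 - a2) * e).
    by rewrite /tilt -/e; ring.
  rewrite T2 -{1}Ve; ring.
transitivity (vdm a1 a2 a3 * u1 + tilt a1 a3 a2 u1 u3 u2 + (a1 - a3) * e).
  by rewrite /tilt /e /three_dir /vdm; ring.
rewrite T3 -{1}Ve; ring.
Qed.

(** The coefficients f and g of the surface of the root (a, p, q), in
    characteristic 3. *)
Definition fcoef a p : {poly F} := dpol a * p%:P.
Definition gcoef a p q : {poly F} :=
  dpol a ^+ 2 * (q%:P + dpol a * (p ^+ 2)%:P) - spol a * (p ^+ 3)%:P.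

Lemma size_fcoef a p : (size (fcoef a p) <= 2)%N.
Proof. by apply: (@leq_sizeM _ 1 0); rewrite ?size_dpol ?size_polyC_leq1. Qed.

Lemma coef_fcoef a p : (fcoef a p)`_1 = p.
Proof.
rewrite (@coef_top_mul _ 1 0) ?size_dpol ?size_polyC_leq1 //.
by rewrite /dpol coefB coefX !coefC /= subr0 mul1r.
Qed.

Lemma size_gcoef a p q : (size (gcoef a p q) <= 4)%N.
Proof.
have sC c : (size (c%:P : {poly F}) <= 1)%N by exact: size_polyC_leq1.
apply: leq_sizeB; last first.
  apply: leq_trans (@leq_sizeM _ 1 0 _ _ _ _) _ => //; exact: size_spol.
apply: (@leq_sizeM _ 2 1); first exact: size_dpolX.
apply: leq_sizeD; first exact: leq_trans (sC _) _.
by apply: (@leq_sizeM _ 1 0); rewrite ?size_dpol ?sC.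
Qed.

(** A common affine curve would pass through the three points (a_i, p_i). *)
Lemma noncollinear_count a1 a2 a3 p1 p2 p3 q1 q2 q3 (s : seq (F * F)) :
  a1 != a2 -> a2 != a3 -> a1 != a3 -> a1 != 0 -> a2 != 0 -> a3 != 0 ->
  tilt a1 a2 a3 p1 p2 p3 != 0 -> uniq s ->
  (forall y, y \in s -> on_three a1 a2 a3 (fcoef a1 p1) (fcoef a2 p2) (fcoef a3 p3)
     (gcoef a1 p1 q1) (gcoef a2 p2 q2) (gcoef a3 p3 q3) y) ->
  (size s <= 26)%N.
Proof.
move=> n12 n23 n13 nz1 nz2 nz3 nzT uniq_s sols.
have nzV := vdm_neq0 n12 n23 n13.
have sW a a' (g : {poly F}) : (size g <= 4)%N -> (size (wpol a a' * g)%R <= 5)%N.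
  by move=> sg; apply: (@leq_sizeM _ 1 3) => //; apply: size_wpol.
have sdf a a' c p : (size (wpol a a' * dpol c ^+ 2 * fcoef c p)%R <= 5)%N.
  apply: (@leq_sizeM _ 3 1); last exact: size_fcoef.
  by apply: (@leq_sizeM _ 1 2); [apply: size_wpol | apply: size_dpolX].
have sA1 : (size (qf1 a1 (fcoef a1 p1) a2 (fcoef a2 p2) a3 (fcoef a3 p3)) <= 5)%N.
  by do 2?[apply: leq_sizeD]; apply: sdf.
have sA0 : (size (qf0 a1 (gcoef a1 p1 q1) a2 (gcoef a2 p2 q2) a3 (gcoef a3 p3 q3)) <= 5)%N.
  by rewrite /qf0; do 2?[apply: leq_sizeD]; apply: sW; apply: size_gcoef.
have sp0 : (size (cf0 a1 (gcoef a1 p1 q1) a2 (gcoef a2 p2 q2)) <= 6)%N.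
  by apply: leq_sizeB; apply: (@leq_sizeM _ 2 3); rewrite ?size_dpolX ?size_gcoef.
have sf : (size (fcoef a1 p1 - fcoef a2 p2)%R <= 2)%N.
  by apply: leq_sizeB; apply: size_fcoef.
apply: (triple_count char3 n12 n23 n13 nz1 sf sA1 sA0 sp0 uniq_s _ _ sols).
  apply/orP; left; apply: contraNneq nzT => K0.
  have := coefK char3 n12 n23 n13 sf sA1 sA0; rewrite K0 coef0 => /esym/eqP.
  rewrite mulf_eq0 (negPf nzV) /= coefB !coef_fcoef.
  rewrite (_ : (qf1 _ _ _ _ _ _)`_4 = three_dir a1 a2 a3 p1 p2 p3) //.
  have top a a' c p : (wpol a a' * dpol c ^+ 2 * fcoef c p)`_4 =
      (a ^+ 2 - a' ^+ 2) * p.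
    rewrite (@coef_top_mul _ 3 1) ?size_fcoef //; last first.
      by apply: (@leq_sizeM _ 1 2); [apply: size_wpol | apply: size_dpolX].
    rewrite (@coef_top_mul _ 1 2) ?size_dpolX ?size_wpol //.
    by rewrite coef_wpol coef_dpolX coef_fcoef; ring.
  by rewrite !coefD !top.
move=> U sU [E1 E2 E3] _ _.
have val a p q : a != 0 -> a *+ 2 * U.[a] ^+ 3 + (gcoef a p q).[a] = 0 ->
    p = U`_1 * a + U`_0.
  move=> nza; rewrite -(size2_eval _ sU) => E; apply: cube_inj.
  have nz2a : a *+ 2 != 0.
    apply: contraNneq nza => a20.
    have -> : a = - (a *+ 2) by char3_ring char3.
    by rewrite a20 oppr0.
  apply: (mulfI nz2a); apply/eqP; rewrite -subr_eq0 -oppr_eq0 -[X in _ == X]E.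
  by rewrite /gcoef /dpol /spol !horner_ringE; apply/eqP; ring.
move: nzT; rewrite (val _ _ _ nz1 E1) (val _ _ _ nz2 E2) (val _ _ _ nz3 E3).
by rewrite tilt_affine eqxx.
Qed.

End Points.

(** * Collinear roots *)

Section Collinear.
Variable F : fieldType.
Hypothesis char3 : 3%:R = 0 :> F.

Let char3P := char3_poly char3.

Implicit Types (a b c k p q u v : F).

(** The coefficients f and g for roots on a line of slope k, when the
    coordinates u and v are measured from the line. Here c is the third
    coordinate of the root in these coordinates. *)
Definition flin k a : {poly F} := - (k%:P * dpol a ^+ 2).
Definition glin a c : {poly F} := dpol a ^+ 2 * c%:P.

Lemma size_glin a c : (size (glin a c) <= 3)%N.
Proof.
by apply: (@leq_sizeM _ 2 0); rewrite ?size_dpolX // size_polyC_leq1.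
Qed.

(** The coefficient of u in the quadratic, up to a constant factor, in terms
    of the elementary symmetric functions of the a_i. It shows the degree of
    that coefficient, and its value at b = a_i, where the last factor
    vanishes. *)
Definition bpol a1 a2 a3 : {poly F} :=
  let s1 := a1 + a2 + a3 in let s2 := a1 * a2 + a2 * a3 + a3 * a1 in
  - ((s1 * s1)%:P * 'X ^+ 2 + (s1 * s2)%:P * 'X
     + ('X + s1%:P) * ('X ^+ 3 - s1%:P * 'X ^+ 2 + s2%:P * 'X - (a1 * a2 * a3)%:P)).

Lemma qf1_flin k a1 a2 a3 : qf1 a1 (flin k a1) a2 (flin k a2) a3 (flin k a3) =
  (- k * vdm a1 a2 a3)%:P * bpol a1 a2 a3.
Proof. by rewrite /qf1 /flin /bpol /vdm /wpol /dpol; char3_ring char3P. Qed.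

Lemma size_bpol a1 a2 a3 : size (bpol a1 a2 a3) = 5.
Proof.
rewrite /bpol size_polyN.
set s1 := _ + a3; set s2 := _ + a3 * a1; set s3 := a1 * a2 * a3.
have sC c n : (size (c%:P * 'X ^+ n : {poly F})%R <= n.+1)%N.
  by apply: (@leq_sizeM _ 0 n); rewrite ?size_polyXn ?size_polyC_leq1.
have sC0 c : (size (c%:P : {poly F})%R <= 1)%N by apply: size_polyC_leq1.
have s3P : size ('X ^+ 3 - s1%:P * 'X ^+ 2 + s2%:P * 'X - s3%:P : {poly F}) = 4.
  rewrite -!addrA size_polyDl size_polyXn // ltnS.
  apply: leq_sizeD; first by rewrite size_polyN sC.
  apply: leq_sizeD; first by rewrite -['X]expr1 (leq_trans (sC _ _)).
  by rewrite size_polyN (leq_trans (sC0 _)).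
rewrite addrC size_polyDl size_mul; rewrite ?s3P; first by rewrite size_XaddC.
- by rewrite -size_poly_gt0 size_XaddC.
- by rewrite -size_poly_gt0 s3P.
- rewrite size_XaddC /= ltnS; apply: leq_sizeD.
    by rewrite (leq_trans (sC _ _)).
  by rewrite -['X]expr1 (leq_trans (sC _ _)).
- by rewrite -size_poly_gt0 size_XaddC.
- by rewrite -size_poly_gt0 s3P.
Qed.

Lemma size_flinB k a a' : (size (flin k a - flin k a')%R <= 2)%N.
Proof.
have -> : flin k a - flin k a' = (- k * (a' - a) *+ 2)%:P * 'X
    + (- k * (a ^+ 2 - a' ^+ 2))%:P by rewrite /flin /dpol; ring.
exact: size_lin.
Qed.

Lemma qf1_flin_neq0 k a1 a2 a3 : vdm a1 a2 a3 != 0 -> k != 0 ->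
  qf1 a1 (flin k a1) a2 (flin k a2) a3 (flin k a3) != 0.
Proof.
move=> nzV nzk; rewrite qf1_flin mulf_eq0 negb_or polyC_eq0 mulf_eq0 oppr_eq0.
by rewrite (negPf nzk) (negPf nzV) -size_poly_eq0 size_bpol.
Qed.

Lemma size_qf1_flin k a1 a2 a3 :
  (size (qf1 a1 (flin k a1) a2 (flin k a2) a3 (flin k a3)) <= 5)%N.
Proof.
rewrite qf1_flin; apply: (@leq_sizeM _ 0 4); rewrite ?size_bpol //.
exact: size_polyC_leq1.
Qed.

Lemma size_qf0_glin a1 c1 a2 c2 a3 c3 :
  (size (qf0 a1 (glin a1 c1) a2 (glin a2 c2) a3 (glin a3 c3)) <= 4)%N.
Proof.
by do 2?[apply: leq_sizeD]; apply: (@leq_sizeM _ 1 2);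
  rewrite ?size_wpol ?size_glin.
Qed.

Lemma coef_qf0_glin a1 c1 a2 c2 a3 c3 :
  (qf0 a1 (glin a1 c1) a2 (glin a2 c2) a3 (glin a3 c3))`_3 =
  three_dir a1 a2 a3 c1 c2 c3.
Proof.
have top a a' c x : (wpol a a' * glin c x)`_3 = (a ^+ 2 - a' ^+ 2) * x.
  rewrite (@coef_top_mul _ 1 2) ?size_wpol ?size_glin // coef_wpol.
  rewrite (@coef_top_mul _ 2 0) ?size_dpolX ?size_polyC_leq1 //.
  by rewrite coef_dpolX coefC /= mul1r; ring.
by rewrite !coefD !top.
Qed.

Lemma cf0_glin a c a' c' :
  cf0 a (glin a c) a' (glin a' c') = dpol a ^+ 2 * dpol a' ^+ 2 * (c - c')%:P.
Proof. by rewrite /cf0 /glin; ring. Qed.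

Lemma dpol_neq0 a : dpol a != 0.
Proof. by rewrite polyXsubC_eq0. Qed.

Lemma two_neq0 a : a != 0 -> a *+ 2 != 0.
Proof.
apply: contraNneq => a20; have -> : a = - (a *+ 2) by char3_ring char3.
by rewrite a20 oppr0.
Qed.

Section Triple.
Variables (a1 a2 a3 c1 c2 c3 k : F).
Hypotheses (n12 : a1 != a2) (n23 : a2 != a3) (n13 : a1 != a3).
Hypotheses (nz1 : a1 != 0) (nz2 : a2 != 0) (nz3 : a3 != 0).

Notation A2 := (qf2 a1 a2 a3).
Notation A1 := (qf1 a1 (flin k a1) a2 (flin k a2) a3 (flin k a3)).
Notation A0 := (qf0 a1 (glin a1 c1) a2 (glin a2 c2) a3 (glin a3 c3)).
Notation K := (elimK A2 A1 A0 (cf3 a1 a2) (cf2 a1 a2)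
   (cf1 a1 (flin k a1) a2 (flin k a2))).
Notation M := (elimM A2 A1 A0 (cf3 a1 a2) (cf2 a1 a2)
   (cf0 a1 (glin a1 c1) a2 (glin a2 c2))).
Notation on_three_lin := (on_three a1 a2 a3 (flin k a1) (flin k a2) (flin k a3)
   (glin a1 c1) (glin a2 c2) (glin a3 c3)).

(** A common affine curve vanishes at the three a_i, so it is 0; but u = 0
    solves the equations only if the c_i are equal. *)
Lemma collinear_count_gen (s : seq (F * F)) : uniq s ->
  (K != 0) || (M != 0) -> (c1 != c2) || (c1 != c3) ->
  (forall y, y \in s -> on_three_lin y) -> (size s <= 26)%N.
Proof.
move=> uniq_s nzKM nc sols.
apply: (triple_count char3 n12 n23 n13 nz1 (size_flinB _ _ _)
  (size_qf1_flin _ _ _ _) _ _ uniq_s nzKM _ sols).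
- exact: leq_trans (size_qf0_glin _ _ _ _ _ _) _.
- rewrite cf0_glin; apply: leq_trans (@leq_sizeM _ 4 0 _ _ _ _) _ => //.
    by apply: (@leq_sizeM _ 2 2); rewrite size_dpolX.
  exact: size_polyC_leq1.
move=> U sU [E1 E2 E3] P12 P13.
have root a c : a != 0 -> a *+ 2 * U.[a] ^+ 3 + (glin a c).[a] = 0 -> root U a.
  move=> nza; rewrite /glin !horner_ringE subrr !mul0r addr0 => /eqP.
  by rewrite mulf_eq0 (negPf (two_neq0 nza)) expf_eq0.
have U0 : U = 0.
  apply/eqP; apply: contraTT sU => nzU; rewrite -ltnNge.
  apply: ltnW; apply: (@max_poly_roots _ _ [:: a1; a2; a3]) => //=.
    by rewrite (root _ _ nz1 E1) (root _ _ nz2 E2) (root _ _ nz3 E3).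
  by rewrite !inE negb_or n12 n13 n23.
have eqc a c a' c' : cf0 a (glin a c) a' (glin a' c') = 0 -> c = c'.
  rewrite cf0_glin => /eqP; rewrite !mulf_eq0 !(negPf (dpol_neq0 _)) /=.
  by rewrite polyC_eq0 subr_eq0 => /eqP.
move: nc; rewrite U0 !expr0n /= !mulr0 !add0r in P12 P13.
by rewrite -(eqc _ _ _ _ P12) -(eqc _ _ _ _ P13) eqxx.
Qed.

Lemma elimM_tilt : tilt a1 a2 a3 c1 c2 c3 != 0 -> M != 0.
Proof.
move=> nzT; apply: contraNneq nzT => M0.
have := coefM10 char3 n12 n23 n13 (size_qf1_flin k a1 a2 a3).
move=> /(_ _ _ _ (size_qf0_glin a1 c1 a2 c2 a3 c3)) E.
have sp0 : (size (cf0 a1 (glin a1 c1) a2 (glin a2 c2)) <= 5)%N.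
  rewrite cf0_glin; apply: (@leq_sizeM _ 4 0); rewrite ?size_polyC_leq1 //.
  by apply: (@leq_sizeM _ 2 2); rewrite size_dpolX.
move: E => /(_ sp0); rewrite M0 coef0 => /esym/eqP.
rewrite mulf_eq0 (negPf (vdm_neq0 n12 n23 n13)) /= coef_qf0_glin.
rewrite cf0_glin (@coef_top_mul _ 4 0) ?size_polyC_leq1 //; last first.
  by apply: (@leq_sizeM _ 2 2); rewrite size_dpolX.
by rewrite (@coef_top_mul _ 2 2) ?size_dpolX // !coef_dpolX !mul1r coefC.
Qed.

(** When c_i = d a_i + e, the coefficients of K and M used so far vanish, but
    d A2 + A0 = 0, which turns M (for nonzero k) or K (for k = 0) into a
    product of nonzero factors. *)
Lemma elim_affine d e : d != 0 ->
  c1 = d * a1 + e -> c2 = d * a2 + e -> c3 = d * a3 + e -> (K != 0) || (M != 0).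
Proof.
move=> nzd e1 e2 e3.
have nzV := vdm_neq0 n12 n23 n13.
have nzA2 : A2 != 0 by rewrite -size_poly_gt0 size_qf2.
have dA2 : d%:P * A2 + A0 = 0.
  by rewrite /qf2 /qf0 /glin e1 e2 e3 /wpol /dpol; char3_ring char3P.
have nzA0 : A0 != 0.
  have -> : A0 = - (d%:P * A2) by apply/eqP; rewrite -addr_eq0 addrC dA2.
  by rewrite oppr_eq0 mulf_neq0 ?polyC_eq0.
have nzp3 : cf3 a1 a2 != 0 by rewrite cf3E // oppr_eq0 wpol_neq0.
have [k0|nzk] := eqVneq k 0.
  apply/orP; left; have fl0 a : flin k a = 0 by rewrite /flin k0 mul0r oppr0.
  have -> : K = - (A2 * A0 * cf3 a1 a2).
    by rewrite /elimK /cf1 /qf1 !fl0 subrr !mulr0 !addr0 mulr0 add0r subr0.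
  by rewrite oppr_eq0 !mulf_neq0.
apply/orP; right.
have -> : M = A1 * cf3 a1 a2 * A0.
  transitivity (A2 * (dpol a1 ^+ 2 * dpol a2 ^+ 2 * (a1 - a2)%:P) * (d%:P * A2 + A0)
     + A1 * cf3 a1 a2 * A0); last by rewrite dA2 mulr0 add0r.
  by rewrite /elimM cf0_glin cf2E e1 e2; ring.
by rewrite !mulf_neq0 // qf1_flin_neq0.
Qed.

End Triple.
End Collinear.

(** Here all c_i are equal to c, so that u = 0 solves all equations. Dividing
    the quadratic and the cubic by u leaves a linear and a quadratic equation
    for the other solutions; [offline] is their resultant. *)
Section ConstantCase.
Variable F : fieldType.
Hypothesis char3 : 3%:R = 0 :> F.

Let char3P := char3_poly char3.

Variables (a1 a2 a3 c k : F).
Hypotheses (n12 : a1 != a2) (n23 : a2 != a3) (n13 : a1 != a3).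
Hypotheses (nz1 : a1 != 0) (nz2 : a2 != 0) (nz3 : a3 != 0).

Notation A2 := (qf2 a1 a2 a3).
Notation A1 := (qf1 a1 (flin k a1) a2 (flin k a2) a3 (flin k a3)).
Notation A0 := (qf0 a1 (glin a1 c) a2 (glin a2 c) a3 (glin a3 c)).
Notation p3 := (cf3 a1 a2).
Notation p2 := (cf2 a1 a2).
Notation p1 := (cf1 a1 (flin k a1) a2 (flin k a2)).
Notation on_three_lin := (on_three a1 a2 a3 (flin k a1) (flin k a2) (flin k a3)
   (glin a1 c) (glin a2 c) (glin a3 c)).

Definition offline : {poly F} := p3 * A1 ^+ 2 - p2 * A1 * A2 + p1 * A2 ^+ 2.

(** At b = a_1 only the first term of the resultant survives, and it vanishes
    only if a_1 + a_2 + a_3 = 0. In that case the value at 0 is used. *)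
Lemma offline_neq0 : k != 0 -> offline != 0.
Proof.
move=> nzk; have nzV := vdm_neq0 n12 n23 n13.
have [s0|nzs] := eqVneq (a1 + a2 + a3) 0.
  have : offline.[0] != 0.
    have -> : offline.[0] = k * (a1 * a2) ^+ 2 * (a2 ^+ 2 - a1 ^+ 2)
        * (vdm a1 a2 a3 * (a1 * a2 * a3)) ^+ 2.
      rewrite /offline qf1_flin // qf2E // /bpol s0 /cf1 /flin /dpol /cf3 /cf2 /spol.
      by rewrite !horner_ringE; ring.
    have nz12 : a2 + a1 != 0.
      by apply: contraNneq nz3 => e; rewrite -s0 [a1 + a2]addrC e add0r.
    have nz21 : a2 - a1 != 0 by rewrite subr_eq0 eq_sym.
    by rewrite subr_sqr; do ?[apply: expf_neq0 | apply: mulf_neq0];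
      rewrite // subr_eq0.
  by apply: contraNneq => ->; rewrite horner0.
have : offline.[a1] != 0.
  have -> : offline.[a1] = (a1 - a2) ^+ 2 * (a1 *+ 2) *
      (k * vdm a1 a2 a3 * (a1 + a2 + a3) * a1 * ((a1 - a2) * (a1 - a3))) ^+ 2.
    have A1a1 : A1.[a1] = k * vdm a1 a2 a3 * (a1 + a2 + a3) * a1
        * ((a1 - a2) * (a1 - a3)).
      rewrite qf1_flin // /bpol !horner_ringE.
      have -> : (a1 - a2) * (a1 - a3) = (a1 + a2 + a3) * a1
          + (a1 * a2 + a2 * a3 + a3 * a1) by char3_ring char3.
      by ring.
    rewrite /offline -A1a1 /cf1 /cf2 /cf3 /dpol /spol; move: (A1) (A2) => q1 q2.
    by rewrite !horner_ringE subrr; ring.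
  by do ?[apply: expf_neq0 | apply: mulf_neq0]; rewrite ?subr_eq0 ?two_neq0.
by apply: contraNneq => ->; rewrite horner0.
Qed.

Lemma size_offline : (size offline <= 12)%N.
Proof.
have sA1 := size_qf1_flin char3 k a1 a2 a3.
have sA2 : (size A2 <= 4)%N by rewrite size_qf2 // vdm_neq0.
have sp3 := size_cf3 char3 a1 a2; have sp2 := size_cf2 a1 a2.
have sp1 : (size p1 <= 6)%N by apply: size_cf1; apply: size_flinB.
apply: leq_sizeD; last by apply: (@leq_sizeM _ 5 6) => //; apply: (@leq_sizeX _ 3 2).
apply: leq_sizeB; last by apply: (@leq_sizeM _ 8 3) => //; apply: (@leq_sizeM _ 4 4).
apply: leq_trans (@leq_sizeM _ 1 8 _ _ _ _) _ => //; exact: (@leq_sizeX _ 4 2).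
Qed.

(** For b with A2(b) <> 0 the solution u is unique and b is a root of
    [offline]. Over the at most 3 roots of A2 there are at most two solutions,
    which A2^2 accounts for. If k = 0 only the latter exist. *)
Lemma collinear_const_count (s : seq (F * F)) : uniq s ->
  (forall y, y \in s -> on_three_lin y /\ y.2 != 0) -> (size s <= 26)%N.
Proof.
move=> uniq_s sols.
have sA2 : size A2 = 4 by rewrite size_qf2 // vdm_neq0.
have nzA2 : A2 != 0 by rewrite -size_poly_gt0 sA2.
have eqs b u : (b, u) \in s -> [/\ A2.[b] * u + A1.[b] = 0, p2.[b] != 0 &
    p3.[b] * u ^+ 2 + p2.[b] * u + p1.[b] = 0].
  move=> /sols[/(on_three_eqs char3 n12) [/= nzp2 Q P] nzu].
  have A00 : A0.[b] = 0.
    rewrite (_ : A0 = 0) ?horner0 // /qf0 /glin /wpol /dpol.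
    by char3_ring char3P.
  have p00 : (cf0 a1 (glin a1 c) a2 (glin a2 c)).[b] = 0.
    by rewrite cf0_glin subrr mulr0 horner0.
  split=> //; apply: (mulIf nzu); rewrite mul0r.
    by rewrite -[RHS]Q A00; ring.
  by rewrite -[RHS]P p00; ring.
pose e := if k == 0 then 1 else offline.
have nze : e != 0.
  rewrite /e; have [_|nzk] := eqVneq k 0; first exact: oner_neq0.
  exact: offline_neq0.
have se : (size e <= 12)%N.
  by rewrite /e; case: ifP => _; rewrite ?size_poly1 ?size_offline.
have root_e b u : (b, u) \in s -> A2.[b] != 0 -> e.[b] = 0.
  move=> bus nzb; have [_ nzu] := sols _ bus; have [L _ P] := eqs _ _ bus.
  rewrite /e; case: eqVneq => [k0|_].
    have A10 : A1.[b] = 0 by rewrite qf1_flin // k0 oppr0 mul0r polyC0 mul0r horner0.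
    by move: L; rewrite A10 addr0 => /eqP; rewrite mulf_eq0 (negPf nzb) (negPf nzu).
  have eA1 : A1.[b] = - (A2.[b] * u) by apply/eqP; rewrite -addr_eq0 addrC L.
  rewrite /offline; move: (A1) (A2) (p1) (p2) (p3) eA1 P => q1 q2 r1 r2 r3 eA1 P.
  rewrite !horner_ringE eA1.
  transitivity (q2.[b] ^+ 2 * (r3.[b] * u ^+ 2 + r2.[b] * u + r1.[b])); first by ring.
  by rewrite P mulr0.
have nzq : e * A2 ^+ 2 != 0 by rewrite mulf_neq0 ?expf_neq0.
rewrite -ltnS; apply: (@leq_trans (size (e * A2 ^+ 2))); last first.
  apply: leq_trans (@leq_sizeM _ 11 6 _ _ _ _) _ => //.
  by apply: (@leq_sizeX _ 3 2); rewrite sA2.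
apply: fiber_count => // b l uniq_l inl.
rewrite mup_geq //.
case: l uniq_l inl => [|u [|v l]] //= uniq_l inl; first by rewrite expr0 dvd1p.
  rewrite expr1 dvdp_XsubCl /root hornerM horner_exp mulf_eq0 expf_eq0 /=.
  have [//|nzb] := eqVneq A2.[b] 0; first by rewrite orbT.
  by rewrite (root_e b u) ?eqxx // inl ?inE.
have [Lu nzp2 Pu] := eqs b u (inl u (mem_head _ _)).
have [Lv _ Pv] : [/\ A2.[b] * v + A1.[b] = 0, p2.[b] != 0 &
    p3.[b] * v ^+ 2 + p2.[b] * v + p1.[b] = 0].
  by apply: eqs; apply: inl; rewrite !inE eqxx orbT.
have nuv : u != v by move: uniq_l; rewrite inE negb_or => /andP[/andP[]].
have [A20 _] := linear_two_roots nuv Lu Lv.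
case: l uniq_l inl => [|w l] /= uniq_l inl.
  apply: dvdp_mull; apply: dvdp_exp2r.
  by rewrite dvdp_XsubCl /root A20.
have [_ _ Pw] : [/\ A2.[b] * w + A1.[b] = 0, p2.[b] != 0 &
    p3.[b] * w ^+ 2 + p2.[b] * w + p1.[b] = 0].
  by apply: eqs; apply: inl; rewrite !inE eqxx !orbT.
move: uniq_l; rewrite !inE !negb_or => /and3P[/and3P[_ nuw _] /andP[nvw _] _].
by have [_ p20 _] := quadratic_three_roots nuv nuw nvw Pu Pv Pw; rewrite p20 eqxx in nzp2.
Qed.

End ConstantCase.

(** * Points joined to three roots *)

Section Linked.
Variable F : fieldType.
Hypothesis char3 : 3%:R = 0 :> F.

Let char3P := char3_poly char3.

Definition point := (F * F * F)%type.
Definition px (x : point) := x.1.1.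
Definition pu (x : point) := x.1.2.
Definition pv (x : point) := x.2.

Implicit Types (x y : point) (t k c : F).

(** By [incident_linked] below, this holds for two points with a common
    neighbour of first coordinate t. *)
Definition linked x y t :=
  [/\ px y != px x, pu y - pu x = (px y - px x) * t &
      pv y - pv x = (px y ^+ 2 - px x ^+ 2) * t ^+ 3 + (px y ^+ 3 - px x ^+ 3) * t ^+ 2].

Definition linked3 x1 x2 x3 y := exists t1 t2 t3,
  [/\ linked x1 y t1, linked x2 y t2, linked x3 y t3 & [/\ t1 != t2, t2 != t3 & t1 != t3]].

Lemma linked_eqn x y t : linked x y t ->
  (px y - px x) ^+ 2 * (pv y - pv x) = (px y + px x) * (pu y - pu x) ^+ 3
    + (px y - px x) ^+ 3 * (pu y - pu x) ^+ 2.
Proof. by case=> _ -> ->; char3_ring char3. Qed.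

Lemma linked_surface x y t : linked x y t ->
  on_surface (px x) (fcoef (px x) (pu x)) (gcoef (px x) (pu x) (pv x))
    (px y) (pu y) (pv y).
Proof.
move=> /linked_eqn E; rewrite /on_surface /fcoef /gcoef /dpol /spol !horner_ringE.
transitivity ((px y - px x) ^+ 2 * (pv y - pv x) + (px y - px x) ^+ 2 * pv x).
  by ring.
by rewrite E; char3_ring char3.
Qed.

(** The third coordinate relative to a line of slope k: the neighbours of a
    vertex of first coordinate k are the points of such a line, and this
    quantity is constant on them. *)
Definition cshift k x := pv x - k ^+ 3 * px x ^+ 2 - k ^+ 2 * px x ^+ 3.

Lemma linked_line_surface k c x y t : linked x y t -> pu x = k * px x + c ->
  on_surface (px x) (flin k (px x)) (glin (px x) (cshift k x))
    (px y) (pu y - (k * px y + c)) (cshift k y).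
Proof.
move=> /linked_eqn E ux; rewrite /on_surface /flin /glin /cshift /dpol !horner_ringE.
move: E; rewrite ux => E.
transitivity ((px y - px x) ^+ 2 * (pv y - pv x) + (px y - px x) ^+ 2 *
  (pv x - k ^+ 3 * px y ^+ 2 - k ^+ 2 * px y ^+ 3)); first by ring.
rewrite E; set w := pu y - (k * px y + c).
have -> : pu y = w + k * px y + c by rewrite /w; ring.
by move: w => w; char3_ring char3.
Qed.

Lemma linked_inj x y y' t t' : linked x y t -> linked x y' t' ->
  (px y, pu y) = (px y', pu y') -> y = y'.
Proof.
case: y y' => [[b u] v] [[b' u'] v'] [/= nb Eu Ev] [/= nb' Eu' Ev'] [eb eu].
rewrite /px /pu /pv /= in nb Eu Ev nb' Eu' Ev' eb eu *; subst b' u'.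
have et : t = t'.
  have nz : b - x.1.1 != 0 by rewrite subr_eq0.
  by apply: (mulfI nz); rewrite -Eu -Eu'.
by congr (_, _); apply: (@addIr _ (- x.2)); rewrite Ev Ev' et.
Qed.

Lemma on_three_perm (a1 a2 a3 : F) f1 f2 f3 g1 g2 g3 (y : F * F) :
  on_three a1 a2 a3 f1 f2 f3 g1 g2 g3 y -> on_three a1 a3 a2 f1 f3 f2 g1 g3 g2 y.
Proof. by case=> w [? ? ?] [? ? ?]; exists w. Qed.

(** The value c_i of the roots plays the part that u_i has in the general
    case: if the points (a_i, c_i) are not collinear, the coefficient of
    degree 10 of M does not vanish for one of the two orders of the last two
    roots. *)
Lemma collinear_count (a1 a2 a3 c1 c2 c3 k : F) (s : seq (F * F)) :
  a1 != a2 -> a2 != a3 -> a1 != a3 -> a1 != 0 -> a2 != 0 -> a3 != 0 -> uniq s ->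
  (forall y : F * F, y \in s -> y.2 != 0 /\
     on_three a1 a2 a3 (flin k a1) (flin k a2) (flin k a3)
       (glin a1 c1) (glin a2 c2) (glin a3 c3) y) -> (size s <= 26)%N.
Proof.
move=> n12 n23 n13 nz1 nz2 nz3 uniq_s sols.
have n32 : a3 != a2 by rewrite eq_sym.
have [/andP[/eqP e12 /eqP e13]|nc] := boolP ((c1 == c2) && (c1 == c3)).
  apply: (@collinear_const_count _ char3 a1 a2 a3 c1 k) => // y /sols[nzy].
  by rewrite -e12 -e13.
rewrite negb_and in nc.
have sols1 (y : F * F) : y \in s -> on_three a1 a2 a3 (flin k a1) (flin k a2) (flin k a3)
       (glin a1 c1) (glin a2 c2) (glin a3 c3) y by case/sols.
have sols2 (y : F * F) : y \in s -> on_three a1 a3 a2 (flin k a1) (flin k a3) (flin k a2)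
       (glin a1 c1) (glin a3 c3) (glin a2 c2) y by move/sols1/on_three_perm.
have [T2|nT2] := eqVneq (tilt a1 a2 a3 c1 c2 c3) 0; last first.
  apply: (collinear_count_gen char3 _ _ _ _ _ _ uniq_s _ nc sols1) => //.
  by rewrite (elimM_tilt char3) ?orbT.
have [T3|nT3] := eqVneq (tilt a1 a3 a2 c1 c3 c2) 0; last first.
  apply: (collinear_count_gen char3 _ _ _ _ _ _ uniq_s _ _ sols2) => //.
    by rewrite (elimM_tilt char3) ?orbT.
  by rewrite orbC.
have [d [e [e1 e2 e3]]] := affine_of_tilt (vdm_neq0 n12 n23 n13) T2 T3.
apply: (collinear_count_gen char3 _ _ _ _ _ _ uniq_s _ nc sols1) => //.
apply: (elim_affine char3 _ n12 n23 n13 nz1 _ e1 e2 e3).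
by apply: contraTneq nc => d0; rewrite e1 e2 e3 d0 !mul0r eqxx.
Qed.

Section Roots.
Variables (x1 x2 x3 : point) (s : seq point).
Hypotheses (uniq_s : uniq s) (sols : forall y, y \in s -> linked3 x1 x2 x3 y).
Hypotheses (nz1 : px x1 != 0) (nz2 : px x2 != 0) (nz3 : px x3 != 0).

Lemma uniq_shadow (h : F -> F -> F) : (forall b, injective (h b)) ->
  uniq [seq (px y, h (px y) (pu y)) | y <- s].
Proof.
move=> inj_h; rewrite map_inj_in_uniq // => y y' /sols[t [_ [_ [L _ _ _]]]].
move=> /sols[t' [_ [_ [L' _ _ _]]]] [eb]; rewrite eb => /inj_h eu.
by apply: (linked_inj L L'); rewrite eb eu.
Qed.

(** If the roots are collinear, the points y on their line are excluded
    because there all t_i would be equal to the slope. *)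
Lemma distinct_count : px x1 != px x2 -> px x2 != px x3 -> px x1 != px x3 ->
  (size s <= 26)%N.
Proof.
move=> n12 n23 n13.
have n32 : px x3 != px x2 by rewrite eq_sym.
have uniq_l := @uniq_shadow (fun b u => u) (fun b => @inj_id F).
set l := (X in uniq X) in uniq_l.
have sl : size l = size s by rewrite size_map.
have sols1 (y : F * F) : y \in l -> on_three (px x1) (px x2) (px x3)
   (fcoef (px x1) (pu x1)) (fcoef (px x2) (pu x2)) (fcoef (px x3) (pu x3))
   (gcoef (px x1) (pu x1) (pv x1)) (gcoef (px x2) (pu x2) (pv x2))
   (gcoef (px x3) (pu x3) (pv x3)) y.
  case/mapP=> z /sols[t1 [t2 [t3 [L1 L2 L3 _]]]] ->; exists (pv z).
    by split; [case: L1 | case: L2 | case: L3].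
  by split; [apply: linked_surface L1 | apply: linked_surface L2 | apply: linked_surface L3].
have [T2|nT2] := eqVneq (tilt (px x1) (px x2) (px x3) (pu x1) (pu x2) (pu x3)) 0; last first.
  by rewrite -sl; apply: (noncollinear_count char3 _ _ _ _ _ _ nT2 uniq_l sols1).
have [T3|nT3] := eqVneq (tilt (px x1) (px x3) (px x2) (pu x1) (pu x3) (pu x2)) 0; last first.
  rewrite -sl; apply: (noncollinear_count char3 _ _ _ _ _ _ nT3 uniq_l) => //.
  by move=> y /sols1/on_three_perm H; exact: H.
have [k [c [e1 e2 e3]]] := affine_of_tilt (vdm_neq0 n12 n23 n13) T2 T3.
have uniq_m := @uniq_shadow (fun b u => u - (k * b + c)) (fun b => @addIr _ _).
rewrite -(size_map (fun y => (px y, pu y - (k * px y + c)))).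
apply: (collinear_count n12 n23 n13 nz1 nz2 nz3 uniq_m) => y.
case/mapP=> z /sols[t1 [t2 [t3 [L1 L2 L3 [n12t _ _]]]]] -> /=; split.
  apply: contraNneq n12t => /eqP; rewrite subr_eq0 => /eqP uz.
  have tk x t : linked x z t -> pu x = k * px x + c -> t = k.
    case=> nz E _ ux; have nzd : px z - px x != 0 by rewrite subr_eq0.
    by apply: (mulfI nzd); rewrite -E uz ux; ring.
  by rewrite (tk _ _ L1 e1) (tk _ _ L2 e2).
exists (cshift k z); first by split; [case: L1 | case: L2 | case: L3].
by split; [apply: linked_line_surface L1 e1 | apply: linked_line_surface L2 e2 |
           apply: linked_line_surface L3 e3].
Qed.

End Roots.
Lemma unique_fiber_count (s : seq point) (q : {poly F}) : uniq s -> q != 0 ->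
  (forall y, y \in s -> q.[px y] = 0) ->
  (forall y z, y \in s -> z \in s -> px y = px z -> y = z) -> (size s < size q)%N.
Proof.
move=> uniq_s nzq root_q inj_s; rewrite -(size_map px).
apply: max_poly_roots => //; last by rewrite map_inj_in_uniq.
by apply/allP => _ /mapP[y ys ->]; apply/eqP/root_q.
Qed.

(** For roots with the same first coordinate, v is eliminated by a linear
    equation for u, in which this slope occurs. *)
Definition chord x x' := (pv x - pv x') / (pu x - pu x').

Lemma linked_same_px x x' y t t' : px x = px x' -> x != x' ->
  linked x y t -> linked x' y t' ->
  pu x != pu x' /\
  (px y - px x) ^+ 3 * (pu y + pu x + pu x') =
    (px y + px x) * (pu x - pu x') ^+ 2 - (px y - px x) ^+ 2 * chord x x'.
Proof.
move=> ea nxx' L L'; have E := linked_eqn L; have E' := linked_eqn L'.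
rewrite -ea in E'.
have nzd : px y - px x != 0 by case: L => nz _ _; rewrite subr_eq0.
have nu : pu x != pu x'.
  apply: contraNneq nxx' => eu; rewrite -eu in E'.
  have /(mulfI (expf_neq0 2 nzd)) ev := etrans E (esym E').
  have {}ev : pv x = pv x' by apply: oppr_inj; apply: (addrI (pv y)).
  move: ea eu ev; case: (x) (x') => [[a u] v] [[a' u'] v'].
  by rewrite /px /pu /pv /= => -> -> ->.
split=> //; have nzu : pu x - pu x' != 0 by rewrite subr_eq0.
have hm : chord x x' * (pu x - pu x') = pv x - pv x' by rewrite divfK.
apply: (mulIf nzu); move: (chord x x') hm => m hm.
transitivity ((px y + px x) * (pu x - pu x') ^+ 3
    - ((px y - px x) ^+ 2 * (pv y - pv x') - (px y - px x) ^+ 2 * (pv y - pv x))).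
  by rewrite E E'; char3_ring char3.
transitivity ((px y + px x) * (pu x - pu x') ^+ 3 - (px y - px x) ^+ 2 * (pv x - pv x')).
  by ring.
by rewrite -hm; ring.
Qed.

Section Degenerate.
Variables (x1 x2 x3 : point) (s : seq point).
Hypotheses (uniq_s : uniq s) (sols : forall y, y \in s -> linked3 x1 x2 x3 y).
Hypotheses (nz1 : px x1 != 0) (n12 : x1 != x2) (n13 : x1 != x3) (n23 : x2 != x3).

Lemma inj_px : px x1 = px x2 ->
  forall y z, y \in s -> z \in s -> px y = px z -> y = z.
Proof.
move=> ea y z /sols[t1 [t2 [t3 [L1 L2 _ _]]]] /sols[t1' [t2' [t3' [L1' L2' _ _]]]] eyz.
have [_ E] := linked_same_px ea n12 L1 L2.
have [_ E'] := linked_same_px ea n12 L1' L2'.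
apply: (linked_inj L1 L1'); congr (_, _) => //.
have nzd : px z - px x1 != 0 by case: L1' => nz _ _; rewrite subr_eq0.
rewrite eyz in E; apply: (@addIr _ (pu x1 + pu x2)); rewrite !addrA.
by apply: (mulfI (expf_neq0 3 nzd)); rewrite E E'.
Qed.

(** The first two roots determine u as a rational function N / d^3 of b.
    Substituting it in the equation of the third root gives a polynomial,
    which does not vanish at the common first coordinate of the first two
    roots. *)
Lemma two_equal_count : px x1 = px x2 -> px x1 != px x3 -> (size s <= 26)%N.
Proof.
move=> ea na3; have [->|] := eqVneq s [::]; first by [].
move=> nz_s; have [y0 y0s] : exists y0, y0 \in s.
  by case: (s) nz_s => // y0 s' _; exists y0; rewrite mem_head.
have nu : pu x1 != pu x2.
  have [t1 [t2 [t3 [L1 L2 _ _]]]] := sols y0s.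
  by have [] := linked_same_px ea n12 L1 L2.
pose d := dpol (px x1); pose d3 := dpol (px x3).
pose N : {poly F} := spol (px x1) * ((pu x1 - pu x2) ^+ 2)%:P
   - d ^+ 2 * (chord x1 x2)%:P - d ^+ 3 * (pu x1 + pu x2)%:P.
pose G : {poly F} := d ^+ 2 * (spol (px x3) * (N - d ^+ 3 * (pu x3)%:P) ^+ 3
     + d3 ^+ 3 * d ^+ 3 * (N - d ^+ 3 * (pu x3)%:P) ^+ 2)
  - d3 ^+ 2 * (spol (px x1) * (N - d ^+ 3 * (pu x1)%:P) ^+ 3
     + d ^+ 6 * (N - d ^+ 3 * (pu x1)%:P) ^+ 2)
  - d ^+ 11 * d3 ^+ 2 * (pv x1 - pv x3)%:P.
have nzG : G != 0.
  have : G.[px x1] != 0.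
    have -> : G.[px x1] = - ((px x1 - px x3) ^+ 2 * ((px x1 *+ 2)
        * ((px x1 *+ 2) * (pu x1 - pu x2) ^+ 2) ^+ 3)).
      by rewrite /G /N /d /d3 /dpol /spol !horner_ringE; ring.
    rewrite oppr_eq0; do ?[apply: expf_neq0 | apply: mulf_neq0];
      by rewrite ?two_neq0 // subr_eq0.
  by apply: contraNneq => ->; rewrite horner0.
have sG : (size G <= 27)%N.
  have sC (c : F) : (size (c%:P : {poly F})%R <= 1)%N by apply: size_polyC_leq1.
  have sdC n (c : F) : (size (d ^+ n * c%:P)%R <= n.+1)%N.
    by rewrite -[n in n.+1]addn0; apply: leq_sizeM; rewrite ?size_dpolX.
  have sN : (size N <= 4)%N.
    apply: leq_sizeB; last exact: sdC.
    apply: leq_sizeB; last exact: leq_trans (sdC _ _) _.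
    by apply: leq_trans (@leq_sizeM _ 1 0 _ _ _ _) _; rewrite ?size_spol.
  have sNu c : (size (N - d ^+ 3 * c%:P)%R <= 4)%N by apply: leq_sizeB.
  have sNu3 c : (size ((N - d ^+ 3 * c%:P) ^+ 3)%R <= 10)%N by apply: (@leq_sizeX _ 3 3).
  have sNu2 c : (size ((N - d ^+ 3 * c%:P) ^+ 2)%R <= 7)%N by apply: (@leq_sizeX _ 3 2).
  (* Each of the five terms of G has degree at most 14. *)
  have sd n : (size (d ^+ n)%R <= n.+1)%N by apply: size_dpolX.
  have sd3 n : (size (d3 ^+ n)%R <= n.+1)%N by apply: size_dpolX.
  apply: (@leq_trans 15) => //; apply: leq_sizeB; last first.
    apply: leq_trans (@leq_sizeM _ 13 0 _ _ _ _) _ => //; exact: (@leq_sizeM _ 11 2).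
  apply: leq_sizeB; apply: (@leq_sizeM _ 2 12) => //; apply: leq_sizeD.
  - by apply: leq_trans (@leq_sizeM _ 1 9 _ _ _ _) _; rewrite ?size_spol.
  - by apply: (@leq_sizeM _ 6 6) => //; apply: (@leq_sizeM _ 3 3).
  - by apply: leq_trans (@leq_sizeM _ 1 9 _ _ _ _) _; rewrite ?size_spol.
  - exact: (@leq_sizeM _ 6 6).
rewrite -ltnS; apply: leq_trans sG; apply: unique_fiber_count => //; last exact: inj_px.
move=> y /sols[t1 [t2 [t3 [L1 L2 L3 _]]]].
have [_ EN] := linked_same_px ea n12 L1 L2.
have E1 := linked_eqn L1; have E3 := linked_eqn L3.
have {}EN : N.[px y] = (px y - px x1) ^+ 3 * pu y.
  rewrite /N /d /dpol /spol !horner_ringE.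
  transitivity ((px y + px x1) * (pu x1 - pu x2) ^+ 2 - (px y - px x1) ^+ 2 * chord x1 x2
    - (px y - px x1) ^+ 3 * (pu x1 + pu x2)); first by ring.
  by rewrite -EN; ring.
rewrite /G /d /d3; move: N EN {nzG G} => N EN.
rewrite /dpol /spol !horner_ringE EN.
transitivity ((px y - px x1) ^+ 11 * ((px y + px x3) * (pu y - pu x3) ^+ 3
    + (px y - px x3) ^+ 3 * (pu y - pu x3) ^+ 2)
  - (px y - px x3) ^+ 2 * (px y - px x1) ^+ 9 * ((px y + px x1) * (pu y - pu x1) ^+ 3
    + (px y - px x1) ^+ 3 * (pu y - pu x1) ^+ 2)
  - (px y - px x1) ^+ 11 * (px y - px x3) ^+ 2 * (pv x1 - pv x3)); first by ring.
by rewrite -E1 -E3; ring.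
Qed.

(** Comparing the two linear equations for u gives a cubic equation for b; its
    leading coefficient is the difference of the u-coordinates of the last two
    roots. *)
Lemma all_equal_count : px x1 = px x2 -> px x1 = px x3 -> (size s <= 26)%N.
Proof.
move=> ea ea'; have [->|] := eqVneq s [::]; first by [].
move=> nz_s; have [y0 y0s] : exists y0, y0 \in s.
  by case: (s) nz_s => // y0 s' _; exists y0; rewrite mem_head.
have nu : pu x2 != pu x3.
  have [_ [t2 [t3 [_ L2 L3 _]]]] := sols y0s.
  by have [] := linked_same_px (etrans (esym ea) ea') n23 L2 L3.
pose d := dpol (px x1).
pose G : {poly F} := d ^+ 3 * (pu x2 - pu x3)%:P
  + (d ^+ 2 * (chord x1 x2 - chord x1 x3)%:P
     - spol (px x1) * ((pu x1 - pu x2) ^+ 2 - (pu x1 - pu x3) ^+ 2)%:P).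
have sC (c : F) : (size (c%:P : {poly F})%R <= 1)%N by apply: size_polyC_leq1.
have sG2 : (size (d ^+ 2 * (chord x1 x2 - chord x1 x3)%:P
     - spol (px x1) * ((pu x1 - pu x2) ^+ 2 - (pu x1 - pu x3) ^+ 2)%:P)%R <= 3)%N.
  apply: leq_sizeB; first by apply: (@leq_sizeM _ 2 0); rewrite ?size_dpolX.
  by apply: leq_trans (@leq_sizeM _ 1 0 _ _ _ _) _; rewrite ?size_spol.
have nzG : G != 0.
  have : G`_3 != 0.
    rewrite /G coefD [X in _ + X]nth_default // addr0.
    by rewrite (@coef_top_mul _ 3 0) ?size_dpolX // coef_dpolX coefC mul1r subr_eq0.
  by apply: contraNneq => ->; rewrite coef0.
have sG : (size G <= 27)%N.
  apply: leq_sizeD; last exact: leq_trans sG2 _.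
  by apply: leq_trans (@leq_sizeM _ 3 0 _ _ _ _) _; rewrite ?size_dpolX.
rewrite -ltnS; apply: leq_trans sG; apply: unique_fiber_count => //; last exact: inj_px.
move=> y /sols[t1 [t2 [t3 [L1 L2 L3 _]]]].
have [_ E2] := linked_same_px ea n12 L1 L2.
have [_ E3] := linked_same_px ea' n13 L1 L3.
rewrite /G /d /dpol /spol !horner_ringE.
transitivity ((px y - px x1) ^+ 3 * (pu y + pu x1 + pu x2)
  - (px y - px x1) ^+ 3 * (pu y + pu x1 + pu x3)
  - ((px y + px x1) * (pu x1 - pu x2) ^+ 2 - (px y - px x1) ^+ 2 * chord x1 x2)
  + ((px y + px x1) * (pu x1 - pu x3) ^+ 2 - (px y - px x1) ^+ 2 * chord x1 x3)).
  by ring.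
by rewrite E2 E3; ring.
Qed.

End Degenerate.

Lemma linked3_perm x1 x2 x3 y : linked3 x1 x2 x3 y ->
  linked3 x1 x3 x2 y /\ linked3 x2 x3 x1 y.
Proof.
case=> t1 [t2 [t3 [L1 L2 L3 [n12 n23 n13]]]]; split.
  by exists t1, t3, t2; split=> //; split=> //; rewrite eq_sym.
by exists t2, t3, t1; split=> //; split=> //; rewrite eq_sym.
Qed.

Theorem linked3_count (x1 x2 x3 : point) (s : seq point) :
  x1 != x2 -> x2 != x3 -> x1 != x3 ->
  px x1 != 0 -> px x2 != 0 -> px x3 != 0 -> uniq s ->
  (forall y, y \in s -> linked3 x1 x2 x3 y) -> (size s <= 26)%N.
Proof.
move=> n12 n23 n13 nz1 nz2 nz3 uniq_s sols.
have n21 : x2 != x1 by rewrite eq_sym.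
have n31 : x3 != x1 by rewrite eq_sym.
have n32 : x3 != x2 by rewrite eq_sym.
have solsB y : y \in s -> linked3 x1 x3 x2 y by move/sols/linked3_perm; case.
have solsC y : y \in s -> linked3 x2 x3 x1 y by move/sols/linked3_perm; case.
have [e12|d12] := eqVneq (px x1) (px x2).
  have [e13|d13] := eqVneq (px x1) (px x3).
    exact: (all_equal_count uniq_s sols).
  exact: (two_equal_count uniq_s sols).
have [e13|d13] := eqVneq (px x1) (px x3).
  exact: (two_equal_count uniq_s solsB).
have [e23|d23] := eqVneq (px x2) (px x3).
  by apply: (two_equal_count uniq_s solsC) => //; rewrite eq_sym.
exact: (distinct_count uniq_s sols).
Qed.

End Linked.

(** * The graph of points *)

Section PointGraph.
Variable F : finFieldType.
Hypothesis char3 : 3%:R = 0 :> F.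
Local Notation point := (F * F * F)%type.
Implicit Types x y z : point.

Definition incident x z := [&& x != z, px x != 0, px z != 0,
  pu x + pu z == px x * px z &
  pv x + pv z == px x ^+ 2 * px z ^+ 3 + px x ^+ 3 * px z ^+ 2].

Lemma incident_sym x z : incident x z = incident z x.
Proof.
rewrite /incident eq_sym [px x * _]mulrC [pu x + _]addrC [pv x + _]addrC.
rewrite [px x ^+ 2 * _ + _]addrC [px x ^+ 3 * _]mulrC [px x ^+ 2 * _]mulrC.
by congr andb; rewrite andbCA.
Qed.

Definition point_edges := [set [set e.1; e.2] | e : point * point & incident e.1 e.2].

Lemma point_edgesP : [forall e in point_edges, #|e| == 2].
Proof.
apply/forall_inP => e /imsetP[[x z] /[!inE] /= /and5P[nxz _ _ _ _] ->].
by rewrite cards2 nxz.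
Qed.

Definition point_graph : sgraph point := SGraph point_edgesP.

Lemma adj_point_graph x z : adj point_graph x z = incident x z.
Proof.
apply/imsetP/idP => [[[a b] /[!inE] /= ab E]|xz]; last by exists (x, z); rewrite ?inE.
have /and5P[nab _ _ _ _] := ab.
have Ein c : (c \in [set x; z]) = (c \in [set a; b]) by rewrite E.
have /set2P memz : z \in [set a; b] by rewrite -Ein set22.
have /set2P[ex|ex] : x \in [set a; b] by rewrite -Ein set21.
  case: memz => ez; last by rewrite ex ez.
  by have := Ein b; rewrite ex ez !inE eqxx orbT orbb eq_sym (negPf nab).
case: memz => ez; first by rewrite ex ez incident_sym.
by have := Ein a; rewrite ex ez !inE eqxx orbb (negPf nab).
Qed.

Lemma incident_linked x y w : incident x w -> incident w y -> x != y ->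
  linked x y (px w).
Proof.
move=> /and5P[_ _ nzw /eqP u1 /eqP v1] /and5P[_ _ _ /eqP u2 /eqP v2] nxy.
have Eu : pu y - pu x = (px y - px x) * px w.
  by transitivity ((pu w + pu y) - (pu x + pu w)); [ring | rewrite u1 u2; ring].
have Ev : pv y - pv x =
    (px y ^+ 2 - px x ^+ 2) * px w ^+ 3 + (px y ^+ 3 - px x ^+ 3) * px w ^+ 2.
  by transitivity ((pv w + pv y) - (pv x + pv w)); [ring | rewrite v1 v2; ring].
split=> //; apply: contraNneq nxy => e; move: Eu Ev; rewrite e !subrr !mul0r addr0.
move=> /eqP; rewrite subr_eq0 => /eqP eu /eqP; rewrite subr_eq0 => /eqP ev.
move: e eu ev; case: (x) (y) => [[? ?] ?] [[? ?] ?].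
by rewrite /px /pu /pv /= => -> -> ->.
Qed.

(** Neighbours of the same vertex are distinguished by their first
    coordinates; so distinct middle vertices give distinct t_i. *)
Lemma incident_px_inj y w w' : incident w y -> incident w' y -> px w = px w' -> w = w'.
Proof.
move=> /and5P[_ _ _ /eqP u1 /eqP v1] /and5P[_ _ _ /eqP u2 /eqP v2] e.
have eu : pu w = pu w' by apply: (@addIr _ (pu y)); rewrite u1 u2 e.
have ev : pv w = pv w' by apply: (@addIr _ (pv y)); rewrite v1 v2 e.
move: e eu ev; case: (w) (w') => [[? ?] ?] [[? ?] ?].
by rewrite /px /pu /pv /= => -> -> ->.
Qed.

Lemma point_graph_free t : (26 < t)%N ->
  ~~ contains point_graph (subdivision (Kst 3 t)).
Proof.
move=> gt_t; apply/negP => /contains_subdivisionP[x [y [w [inj_a adjs]]]].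
have xw i j : incident (x i) (w i j).
  by rewrite -adj_point_graph; have [] := adjs i j.
have wy i j : incident (w i j) (y j).
  by rewrite -adj_point_graph; have [] := adjs i j.
pose i0 : 'I_3 := ord0; pose i1 : 'I_3 := lift ord0 ord0; pose i2 : 'I_3 := ord_max.
have nx i i' : i != i' -> x i != x i'.
  apply: contra => /eqP E.
  by have /inj_a[->] : assemble x y w (inl (inl i)) = assemble x y w (inl (inl i')) by [].
have nxy i j : x i != y j.
  apply/eqP => E.
  by have /inj_a : assemble x y w (inl (inl i)) = assemble x y w (inl (inr j)) by [].
have npw i i' j : i != i' -> px (w i j) != px (w i' j).
  apply: contra => /eqP/(incident_px_inj (wy i j) (wy i' j)) E.
  by have /inj_a[->] : assemble x y w (inr (i, j)) = assemble x y w (inr (i', j)) by [].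
have nz i : px (x i) != 0.
  by have /and5P[] := xw i (Ordinal (ltn_trans (ltn0Sn 25) gt_t)).
have inj_y : injective y.
  move=> j j' E.
  by have /inj_a[] : assemble x y w (inl (inr j)) = assemble x y w (inl (inr j')) by [].
suff : (size (codom y) <= 26)%N by rewrite size_codom card_ord leqNgt gt_t.
apply: (@linked3_count F char3 (x i0) (x i1) (x i2)); rewrite ?nx ?nz //.
  exact/injectiveP.
move=> _ /codomP[j ->]; exists (px (w i0 j)), (px (w i1 j)), (px (w i2 j)).
by split; rewrite ?npw //; apply: incident_linked (xw _ j) (wy _ j) (nxy _ j).
Qed.

(** Every nonzero t gives a neighbour, except possibly the first coordinate of
    x, for which the neighbour could be x itself. *)
Lemma point_graph_degree x : px x != 0 -> (#|F| - 2 <= #|nbrs point_graph x|)%N.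
Proof.
move=> nzx; pose z t : point :=
  (t, px x * t - pu x, px x ^+ 2 * t ^+ 3 + px x ^+ 3 * t ^+ 2 - pv x).
have inj_z : injective z by move=> t t' [].
apply: leq_trans (_ : #|z @: ~: [set 0%R; px x]| <= _)%N.
  rewrite card_imset // cardsCs setCK cards2 leq_sub2l //.
  by case: (_ != _).
apply/subset_leq_card/subsetP => y /imsetP[t /[!inE] /[!negb_or] /andP[nzt ntx] ->].
rewrite adj_point_graph; apply/and5P; split => //; rewrite /px /pu /pv /=.
- by apply: contraNneq ntx => ->.
- by apply/eqP; ring.
- by apply/eqP; ring.
Qed.

Lemma point_graph_edges :
  ((#|F| - 1) * #|F| ^ 2 * (#|F| - 2) <= #|edges point_graph|.*2)%N.
Proof.
rewrite -handshake.
have -> : ((#|F| - 1) * #|F| ^ 2)%N = #|[set x : point | px x != 0]|.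
  have -> : [set x : point | px x != 0] = setX (setX [set~ 0] [set: F]) [set: F].
    by apply/setP => -[[a u] v]; rewrite !inE !andbT.
  by rewrite !cardsX cardsC1 !cardsT -subn1 -mulnA.
rewrite -sum_nat_const.
apply: leq_trans (_ : \sum_(x in [set x : point | px x != 0%R]) #|nbrs point_graph x| <= _)%N.
  by apply: leq_sum => x; rewrite inE; apply: point_graph_degree.
by rewrite [leqRHS](bigID (mem [set x : point | px x != 0])) leq_addr.
Qed.

End PointGraph.

Lemma turan_lower (k : nat) (n : nat) : (0 < k)%N -> ((3 ^ k) ^ 3 <= n)%N ->
  ((3 ^ k - 1) * (3 ^ k) ^ 2 * (3 ^ k - 2) <= (turan n (subdivision (Kst 3 30))).*2)%N.
Proof.
move=> k_gt0 le_n; have [F chF cardF] := pPrimePowerField (isT : prime 3) k_gt0.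
have char3 : 3%:R = 0 :> F by move: chF; rewrite inE => /andP[_ /eqP].
rewrite -cardF; apply: leq_trans (point_graph_edges F) _; rewrite leq_double.
apply: leq_turan => //; first by rewrite !card_prod cardF -mulnA; exact: le_n.
exact: point_graph_free.
Qed.

Import Order.TTheory Num.Theory.

(** * The Turan number *)

Lemma powR_cube (R : realType) (a : nat) : ((a ^ 3)%:R : R) `^ (4 / 3) = (a ^ 4)%:R.
Proof.
rewrite natrX -powR_mulrn ?ler0n // -powRrM.
have -> : 3%:R * (4 / 3) = 4%:R :> R by rewrite mulrCA divff ?mulr1 // pnatr_eq0.
by rewrite powR_mulrn ?ler0n // natrX.
Qed.

Theorem corollary1p5 (R : realType) :
  exists c C : R, 0 < c /\ 0 < C /\
    exists n0 : nat, forall n : nat, (n0 <= n)%N ->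
      c * n%:R `^ (4 / 3) <= (turan n (subdivision (Kst 3 30)))%:R /\
      (turan n (subdivision (Kst 3 30)))%:R <= C * n%:R `^ (4 / 3).
Proof.
have [C1 [D0 [D0_gt0 upper]]] := turan_upper (isT : (0 < 30)%N).
exists 324%:R^-1, (81 * C1).+1%:R; split; first by rewrite invr_gt0 ltr0n.
split; first by rewrite ltr0n.
exists (maxn 729 (D0 ^ 3)) => n; rewrite geq_max => /andP[le_n le_Dn].
pose k := trunc_log 27 n; pose q := (3 ^ k)%N; set ex := turan _ _.
have n_gt0 : (0 < n)%N by apply: leq_trans le_n.
have cubeq j : ((3 ^ j) ^ 3 = 27 ^ j)%N by rewrite -expnM mulnC expnM.
have le_qn : (q ^ 3 <= n)%N by rewrite cubeq trunc_logP.
(* The upper bound is applied with 3 q instead of the cube root of n. *)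
have lt_nq : (n < (3 * q) ^ 3)%N by rewrite -expnS cubeq trunc_log_ltn.
have k_gt1 : (1 < k)%N by apply: trunc_log_max; rewrite // -[(27 ^ 2)%N]/729.
have q_ge9 : (9 <= q)%N by rewrite -[9%N]/(3 ^ 2)%N leq_exp2l.
have pow_mono (a b : nat) : (a <= b)%N -> (a%:R : R) `^ (4 / 3) <= b%:R `^ (4 / 3).
  move=> le_ab; apply: ge0_ler_powR; rewrite ?nnegrE ?ler0n ?ler_nat //.
  by rewrite divr_ge0 ?ler0n.
have le4 : (q ^ 4 <= 4 * ex)%N.
  have := turan_lower (ltnW k_gt1) le_qn; rewrite -/q -/ex.
  have : (q ^ 2 <= 2 * ((q - 1) * (q - 2)))%N by rewrite -mulnn; nia.
  move=> le_q2.
  have : (q ^ 2 * q ^ 2 <= 2 * ((q - 1) * (q - 2)) * q ^ 2)%N by rewrite leq_mul2r le_q2 orbT.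
  rewrite -expnD => le_q4 le_ex; apply: leq_trans le_q4 _.
  have -> : (2 * ((q - 1) * (q - 2)) * q ^ 2 = 2 * ((q - 1) * q ^ 2 * (q - 2)))%N by ring.
  have -> : (4 * ex = 2 * ex.*2)%N by rewrite -mul2n mulnA.
  by rewrite leq_mul2l.
split.
  rewrite mulrC ler_pdivrMr ?ltr0n //.
  apply: le_trans (pow_mono _ _ (ltnW lt_nq)) _; rewrite powR_cube -natrM ler_nat.
  rewrite expnMn -[(3 ^ 4)%N]/81%N -[324%N]/(4 * 81)%N mulnA mulnC leq_mul2r.
  by rewrite mulnC le4 orbT.
have le_D : (D0 <= 3 * q)%N.
  by rewrite -(@leq_exp2r _ _ 3) // (leq_trans le_Dn) // ltnW.
have le_ex : (ex <= C1 * (3 * q) ^ 4)%N.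
  apply: leq_trans (upper n (3 * q)%N le_D (ltnW lt_nq)); rewrite -/ex -addnn.
  exact: leq_addr.
apply: le_trans (_ : (81 * C1 * q ^ 4)%:R <= _).
  by rewrite ler_nat (leq_trans le_ex) // expnMn -[(3 ^ 4)%N]/81%N mulnCA mulnA.
rewrite natrM ler_pM ?ler0n ?ler_nat ?leqnSn //.
by rewrite -powR_cube pow_mono.
Qed.
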